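(* Let $\mathcal H$ be a separable Hilbert space, let $A,B,C$ be (possibly unbounded) normal operators on $\mathcal H$, and let $\lambda_A,\lambda_B,\lambda_C$ be scalar-valued spectral measures for $A,B,C$ respectively. Then the triple operator integral mapping $$\Gamma^{A,B,C}\colon L^{\infty}(\lambda_A\times\lambda_B\times\lambda_C)\longrightarrow B_2(S^2(\mathcal H)\times S^2(\mathcal H),S^2(\mathcal H))$$ is an isometry.
   Context: For a normal operator $A$ on $\mathcal H$, $\sigma(A)$ is its spectrum and $E^A$ its spectral measure. A scalar-valued spectral measure for $A$ is a positive finite measure $\lambda_A$ on the Borel subsets of $\sigma(A)$ having the same sets of measure zero as $E^A$. For $f\in L^\infty(\lambda_A)$, $f(A)=\int_{\sigma(A)}f\,dE^A$. $S^2(\mathcal H)$ is the space of Hilbert-Schmidt operators on $\mathcal H$ with norm $\|T\|_2=(\mathrm{tr}(|T|^2))^{1/2}$. $B_2(S^2(\mathcal H)\times S^2(\mathcal H),S^2(\mathcal H))$ is the Banach space of bounded bilinear maps with norm $\|T\|=\sup\{\|T(X,Y)\|_2:\|X\|_2\le1,\|Y\|_2\le1\}$; it is the dual of the projective tensor product $S^2(\mathcal H)\hat\otimes S^2(\mathcal H)\hat\otimes S^2(\mathcal H)$ through $\langle T,X\otimes Y\otimes Z\rangle=\mathrm{tr}(T(X,Y)Z)$, which defines its $w^*$-topology. $L^\infty(\lambda_A\times\lambda_B\times\lambda_C)$ carries its $w^*$-topology as the dual of $L^1$. The triple operator integral mapping $\Gamma^{A,B,C}$ is the unique $w^*$-continuous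 linear contraction $L^{\infty}(\lambda_A\times\lambda_B\times\lambda_C)\to B_2(S^2(\mathcal H)\times S^2(\mathcal H),S^2(\mathcal H))$ such that $\Gamma^{A,B,C}(f_1\otimes f_2\otimes f_3)(X,Y)=f_1(A)Xf_2(B)Yf_3(C)$ for all $f_1\in L^\infty(\lambda_A)$, $f_2\in L^\infty(\lambda_B)$, $f_3\in L^\infty(\lambda_C)$, $X,Y\in S^2(\mathcal H)$ (such a map exists and is unique). *)

(* Defs.v *)
From HB Require Import structures.
From mathcomp Require Import all_boot all_order all_algebra complex.
From mathcomp Require Import all_classical all_reals all_analysis.
From mathcomp.analysis.showcase Require summability.

Set Implicit Arguments.
Unset Strict Implicit.
Unset Printing Implicit Defensive.

Import Order.TTheory GRing.Theory Num.Theory.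
Import numFieldNormedType.Exports.

Local Open Scope classical_set_scope.
Local Open Scope ring_scope.

(* The complex plane with its Borel sigma-algebra.  [R[i]^o] is [R[i]] seen as
   a normed module over itself, whence its topology. *)
Notation borelC R := (g_sigma_algebraType (@open (R[i])^o)).

Section complex_functions.
Context {d} {T : measurableType d} {R : realType}.
Implicit Types (mu : {measure set T -> \bar R}) (f g : T -> R[i]).

Definition cmeasurable f := measurable_fun setT (f : T -> borelC R).

(* Meaningful when [Re f] and [Im f] are integrable. *)
Definition cintegral (mu : set T -> \bar R) f : R[i] :=
  (fine (\int[mu]_x (complex.Re (f x))%:E) +i*
   fine (\int[mu]_x (complex.Im (f x))%:E))%C.

Definition Linf_norm mu f : \bar R :=
  Lnorm mu +oo%E (fun x => (Normc.normc (f x))%:E).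

(* Elements of L^oo and L^1 are represented by functions; equality in these
   spaces is equality almost everywhere. *)
Definition Linf mu : set (T -> R[i]) :=
  [set f | cmeasurable f /\ (Linf_norm mu f < +oo)%E].

Definition L1 mu : set (T -> R[i]) :=
  [set g | cmeasurable g /\ (\int[mu]_x (Normc.normc (g x))%:E < +oo)%E].

(* Convergence in the w*-topology of L^oo, i.e. in the initial topology of the
   functionals given by the elements of L^1. *)
Definition wstar_cvg_Linf mu (F : set_system (T -> R[i])) f :=
  forall g, L1 mu g ->
    (fun h : T -> R[i] => cintegral mu (fun x => h x * g x) : R[i]^o) @ F
      --> (cintegral mu (fun x => f x * g x) : R[i]^o).

End complex_functions.

Definition separable (T : topologicalType) :=
  exists2 D : set T, countable D & dense D.

(* A partially defined operator on H; the values of [act] outside of [dom] are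
   irrelevant. *)
Record partial_op (H : Type) := PartialOp { dom : set H ; act :> H -> H }.

Definition total_op (H : Type) (T : H -> H) : partial_op H := PartialOp setT T.

Section hilbert.
Context {R : realType} {H : completeNormedModType R[i]}.
(* Linear in the first argument, conjugate-linear in the second one. *)
Context (dot : {dot H for Num.conj}).

Definition hilbert_product := forall x : H, dot x x = `|x| ^+ 2.

Section operators.
Implicit Types (A B : partial_op H).

Definition linear_op A :=
  dom A 0 /\
  forall (a : R[i]) (x y : H), dom A x -> dom A y ->
    dom A (a *: x + y) /\ A (a *: x + y) = a *: A x + A y.

Definition closed_op A :=
  closed [set xy : (H * H)%type | dom A xy.1 /\ xy.2 = A xy.1].

(* [act (adjoint A) y] is well determined when [dom A] is dense. *)
Definition adjoint A : partial_op H :=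
  let adj_at y := [set z | forall x, dom A x -> dot (A x) y = dot x z] in
  PartialOp [set y | adj_at y !=set0] (fun y => xget 0 (adj_at y)).

Definition comp_op A B : partial_op H :=
  PartialOp [set x | dom B x /\ dom A (B x)] (A \o B).

Definition same_op A B :=
  dom A = dom B /\ forall x, dom A x -> A x = B x.

Definition normal_op A :=
  [/\ linear_op A, dense (dom A), closed_op A &
      same_op (comp_op (adjoint A) A) (comp_op A (adjoint A))].

Definition bounded_op (T : H -> H) :=
  linear T /\ exists M : R, forall x, `|T x| <= (M%:C)%C * `|x|.

(* The complement of the set of z such that A - z is a bijection of [dom A]
   onto H with a bounded inverse S. *)
Definition spectrum A : set R[i] :=
  ~` [set z | exists2 S, bounded_op S &
        (forall y, dom A (S y) /\ A (S y) - z *: S y = y) /\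
        (forall x, dom A x -> S (A x - z *: x) = x)].

End operators.

Section spectral_measures.
Implicit Types (E : set (borelC R) -> H -> H) (f : R[i] -> R[i]).

Definition orthogonal_projection (P : H -> H) :=
  [/\ linear P, forall x, P (P x) = P x &
      forall x y, dot (P x) y = dot x (P y)].

Definition projection_valued_measure E :=
  [/\ forall S, measurable S -> orthogonal_projection (E S),
      forall x, E setT x = x,
      forall S S', measurable S -> measurable S' ->
        forall x, E (S `&` S') x = E S (E S' x) &
      forall F : nat -> set (borelC R), (forall n, measurable (F n)) ->
        trivIset setT F ->
        forall x, (fun n => \sum_(0 <= k < n) E (F k) x) @ \oo
          --> E (\bigcup_n F n) x].

(* The finite positive measure E_{x,x}. *)
Definition diag_measure E (x : H) (S : set (borelC R)) : \bar R :=
  (complex.Re (dot (E S x) x))%:E.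

(* The integral of f with respect to the complex measure
   E_{x,y} : S |-> <E(S) x, y>, which by polarization is
   4^-1 * \sum_(k < 4) i^k E_{x + i^k y, x + i^k y}. *)
Definition polar_integral E f (x y : H) : R[i] :=
  4^-1 * \sum_(k < 4) 'i ^+ k * cintegral (diag_measure E (x + 'i ^+ k *: y)) f.

(* The integral of f with respect to E, for f (essentially) bounded: the
   bounded operator T such that <T x, y> is the integral of f with respect to
   E_{x,y}. *)
Definition spectral_integral E f : H -> H :=
  get [set T | bounded_op T /\
               forall x y, dot (T x) y = polar_integral E f x y].

(* E is the spectral measure of A, seen as a measure on the Borel subsets of
   the complex plane which is concentrated on the spectrum of A.  The last two
   clauses say that A is the (unbounded) integral of z with respect to E: its
   domain consists of the x such that |z|^2 is E_{x,x}-integrable, and its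
   values are obtained from truncations of z. *)
Record is_spectral_measure (A : partial_op H) E : Prop := IsSpectralMeasure {
  spectral_pvm : projection_valued_measure E ;
  spectral_support : forall x, E (spectrum A) x = x ;
  spectral_dom : dom A =
    [set x | (\int[diag_measure E x]_z (Normc.normc z ^+ 2)%:E < +oo)%E] ;
  spectral_act : forall x, dom A x ->
    (fun n : nat => spectral_integral E
       (fun z => if Normc.normc z <= n%:R then z else 0) x) @ \oo --> A x }.

(* lam is a scalar-valued spectral measure for A, where E is the spectral
   measure of A. *)
Definition scalar_spectral_measure (A : partial_op H) E
    (lam : {finite_measure set (borelC R) -> \bar R}) :=
  lam (~` spectrum A) = 0%E /\
  forall S, measurable S -> (lam S = 0%E <-> forall x, E S x = 0).

End spectral_measures.

Section hilbert_schmidt.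
Implicit Types (T X Y Z : H -> H).

Definition orthonormal_basis (B : set H) :=
  (forall e e', B e -> B e' -> dot e e' = (e == e')%:R) /\
  (forall x, (forall e, B e -> dot x e = 0) -> x = 0).

(* A fixed orthonormal basis, used to compute traces. *)
Definition basis_of_H : set H := xget set0 orthonormal_basis.

(* |T|^2 = T^* T *)
Definition abs_sq T : H -> H := adjoint (total_op T) \o T.

(* Trace of a positive operator, possibly infinite. *)
Definition pos_trace T : \bar R :=
  \esum_(e in basis_of_H) (complex.Re (dot (T e) e))%:E.

(* Trace of a trace class operator: unordered sum over the basis. *)
Definition trace T : R[i] :=
  summability.sum
    (fun e => (if e \in basis_of_H then dot (T e) e else 0) : R[i]^o).

Definition hs_norm T : \bar R := (pos_trace (abs_sq T) `^ 2^-1)%E.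

Definition hilbert_schmidt : set (H -> H) :=
  [set T | bounded_op T /\ (hs_norm T < +oo)%E].

Local Notation S2 := hilbert_schmidt.

(* Maps S2 x S2 -> S2 are represented by functions of arbitrary operators; only
   their values on S2 x S2 matter. *)
Implicit Types (G : (H -> H) -> (H -> H) -> (H -> H)).

Definition bilinear_norm G : \bar R :=
  ereal_sup [set hs_norm (G XY.1 XY.2) | XY in
    [set XY : (H -> H) * (H -> H) |
      [/\ S2 XY.1, S2 XY.2, (hs_norm XY.1 <= 1)%E & (hs_norm XY.2 <= 1)%E]]].

Definition bounded_bilinear : set ((H -> H) -> (H -> H) -> (H -> H)) :=
  [set G | [/\ forall X Y, S2 X -> S2 Y -> S2 (G X Y),
      forall (a : R[i]) X X' Y, S2 X -> S2 X' -> S2 Y ->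
        G (a *: X + X') Y = a *: G X Y + G X' Y,
      forall (a : R[i]) X Y Y', S2 X -> S2 Y -> S2 Y' ->
        G X (a *: Y + Y') = a *: G X Y + G X Y' &
      (bilinear_norm G < +oo)%E]].

(* The elements of the completed projective tensor product of three copies of
   S2 are the sums of the series \sum_n X_n (x) Y_n (x) Z_n with
   \sum_n |X_n|_2 |Y_n|_2 |Z_n|_2 finite. *)
Definition proj_tensor (X Y Z : nat -> H -> H) :=
  (forall n, [/\ S2 (X n), S2 (Y n) & S2 (Z n)]) /\
  (\sum_(0 <= n <oo) hs_norm (X n) * hs_norm (Y n) * hs_norm (Z n) < +oo)%E.

Definition bilinear_pairing G (X Y Z : nat -> H -> H) : R[i] :=
  lim ((fun n => \sum_(0 <= k < n) trace (G (X k) (Y k) \o Z k) : R[i]^o)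
       @ \oo).

(* Convergence in the w*-topology of B_2(S2 x S2, S2), i.e. in the initial
   topology of the functionals given by the projective tensor product. *)
Definition wstar_cvg_bilinear
    (F : set_system ((H -> H) -> (H -> H) -> (H -> H))) G :=
  forall X Y Z : nat -> H -> H, proj_tensor X Y Z ->
    (fun G' => bilinear_pairing G' X Y Z : R[i]^o) @ F
      --> (bilinear_pairing G X Y Z : R[i]^o).

End hilbert_schmidt.

Section triple_operator_integral.
Context (lA lB lC : {finite_measure set (borelC R) -> \bar R}).
Context (EA EB EC : set (borelC R) -> H -> H).

Definition triple_product :
    {measure set (borelC R * borelC R * borelC R)%type -> \bar R} :=
  ((lA \x lB) \x lC)%E.

Definition tensor3 (f1 f2 f3 : R[i] -> R[i])
    (s : borelC R * borelC R * borelC R) : R[i] :=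
  f1 s.1.1 * f2 s.1.2 * f3 s.2.

Local Notation Loo := (Linf triple_product).
Local Notation S2 := hilbert_schmidt.

(* The characterization of the triple operator integral mapping.
   Continuity is expressed by filters on the functions representing the
   elements of L^oo. *)
Record is_triple_operator_integral
    (Gam : (borelC R * borelC R * borelC R -> R[i]) ->
           (H -> H) -> (H -> H) -> (H -> H)) : Prop :=
  IsTripleOperatorIntegral {
  toi_codomain : forall phi, Loo phi -> bounded_bilinear (Gam phi) ;
  toi_ae : forall phi psi, Loo phi -> Loo psi ->
    ae_eq triple_product setT phi psi ->
    forall X Y, S2 X -> S2 Y -> Gam phi X Y = Gam psi X Y ;
  toi_linear : forall (a : R[i]) phi psi, Loo phi -> Loo psi ->
    forall X Y, S2 X -> S2 Y ->
      Gam (fun s => a * phi s + psi s) X Y = a *: Gam phi X Y + Gam psi X Y ;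
  toi_contraction : forall phi, Loo phi ->
    (bilinear_norm (Gam phi) <= Linf_norm triple_product phi)%E ;
  toi_wstar_continuous : forall F, ProperFilter F -> F Loo ->
    forall phi, Loo phi -> wstar_cvg_Linf triple_product F phi ->
      wstar_cvg_bilinear (Gam @ F) (Gam phi) ;
  toi_tensor : forall f1 f2 f3, Linf lA f1 -> Linf lB f2 -> Linf lC f3 ->
    forall X Y, S2 X -> S2 Y ->
      Gam (tensor3 f1 f2 f3) X Y =
        spectral_integral EA f1 \o X \o spectral_integral EB f2 \o Y \o
        spectral_integral EC f3 }.

End triple_operator_integral.

End hilbert.

(* Main.v *)
Require Import Defs.
From HB Require Import structures.
From mathcomp Require Import all_boot all_order all_algebra complex finmap.
From mathcomp Require Import all_classical all_reals all_analysis.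
From mathcomp Require Import ring lra.
From mathcomp.analysis.showcase Require summability.
From mathcomp Require Import measurable_realfun ess_sup_inf.
Import Order.TTheory GRing.Theory Num.Theory.
Import numFieldNormedType.Exports.

(** Contractivity of the triple operator integral mapping is part of its
    characterization, so only the lower bound |phi|_oo <= |Gam phi| =: M has to
    be proved. It comes from testing Gam phi on rank one operators.

    For vectors a, b, c, pair Gam phi with the elementary tensor of the rank one
    operators <., b> a, <., c> b and <., a> c. The resulting functional of phi is
    w*-continuous, and takes the value nu_a(S1) nu_b(S2) nu_c(S3) at the
    indicator of a box S1 x S2 x S3, where nu_a(S) = <E^A(S) a, a> and likewise
    for b and c. By a Dynkin argument it is the integral against the product
    measure nu = nu_a x nu_b x nu_c. Replacing the vectors by E^A(S1) a,
    E^B(S2) b and E^C(S3) c restricts the integral to the box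
    ([rank1_value_restrict]). Since <., b> a has Hilbert-Schmidt norm
    |a| |b|, this bounds the modulus of the integral of phi over any box by
    M times the measure of the box ([rank1_value_le]).

    These averages over boxes control phi pointwise: for |w| <= 1 the integral of
    M - Re (w phi) is nonnegative on boxes, hence on all measurable sets by the
    monotone class theorem ([ge0_on_boxes]), so Re (w phi) <= M almost
    everywhere. Countably many w are enough to conclude that |phi| <= M almost
    everywhere for nu ([ae_le_bilinear_norm]).

    Finally a, b, c run through a dense sequence. A set which is null for all
    the measures nu_a is null for E^A, hence for lambda_A, and by Fubini's theorem
    this property passes to products ([dominated_by_family_prod]). So |phi| <= M
    almost everywhere for lambda_A x lambda_B x lambda_C.

    The traces and Hilbert-Schmidt norms of rank one operators rely on
    orthonormal bases: their existence, expansions along the net of finite sets,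
    Parseval's identity, and the existence of adjoints of bounded operators. *)

Set Implicit Arguments.
Unset Strict Implicit.
Unset Printing Implicit Defensive.
Local Open Scope classical_set_scope.
Local Open Scope ring_scope.
#[local] Existing Instance summability.totally_filter.

(** * Hilbert space geometry *)

Lemma linear_scale (K : nzRingType) (U V : lmodType K) (f : U -> V) (k : K) x :
  linear f -> f (k *: x) = k *: f x.
Proof.
move=> linf; pose g : {linear U -> V} :=
  HB.pack f (GRing.isLinear.Build _ _ _ _ _ linf).
by rewrite -[f]/(g : U -> V) linearZ.
Qed.

Section inner_product.
Context (R : realType) (H : completeNormedModType R[i]).
Context (dot : {dot H for Num.conj}) (Hdot : hilbert_product dot).
Implicit Types (x y z u v : H) (a b : R[i]).

Lemma dotDl z : {morph dot^~ z : x y / x + y}. Proof. exact: linearDl. Qed.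
Lemma dotDr z : {morph dot z : x y / x + y}. Proof. exact: linearDr. Qed.
Lemma dotBl z : {morph dot^~ z : x y / x - y}. Proof. exact: linearBl. Qed.
Lemma dotBr z : {morph dot z : x y / x - y}. Proof. exact: linearBr. Qed.
Lemma dotZl z a x : dot (a *: x) z = a * dot x z.
Proof. exact: linearZl_LR. Qed.
Lemma dotZr z a x : dot z (a *: x) = a^* * dot z x.
Proof. exact: linearZr_LR. Qed.
Lemma dot0l z : dot 0 z = 0. Proof. exact: linear0l. Qed.
Lemma dot0r z : dot z 0 = 0. Proof. exact: linear0r. Qed.
Lemma dotC x y : dot x y = (dot y x)^*.
Proof. by rewrite hermC /= mul1r. Qed.
Lemma dot_suml I (r : seq I) (P : pred I) (F : I -> H) z :
  dot (\sum_(i <- r | P i) F i) z = \sum_(i <- r | P i) dot (F i) z.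
Proof. exact: (big_morph (dot^~ z) (dotDl z) (dot0l z)). Qed.
Lemma dot_sumr I (r : seq I) (P : pred I) (F : I -> H) z :
  dot z (\sum_(i <- r | P i) F i) = \sum_(i <- r | P i) dot z (F i).
Proof. exact: (big_morph (dot z) (dotDr z) (dot0r z)). Qed.

Lemma dot_injl x y : (forall z, dot x z = dot y z) -> x = y.
Proof.
move=> xy; apply/eqP; rewrite -subr_eq0 -normr_eq0 -sqrf_eq0 -Hdot.
by rewrite dotBl xy subrr.
Qed.

Lemma dot_norm_le x y : `|dot x y| <= `|x| * `|y|.
Proof.
have [->|y0] := eqVneq y 0; first by rewrite dot0r normr0 normr0 mulr0.
have ny0 : `|y| != 0 by rewrite normr_eq0.
have ny_gt0 : 0 < `|y| by rewrite normr_gt0.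
(* the component of x orthogonal to y has nonnegative square norm *)
pose t := dot x y / `|y| ^+ 2.
have : 0 <= dot (x - t *: y) (x - t *: y) by rewrite Hdot exprn_ge0.
have -> : dot (x - t *: y) (x - t *: y) = `|x| ^+ 2 - `|dot x y| ^+ 2 / `|y| ^+ 2.
  rewrite dotBl !dotBr !dotZl !dotZr !Hdot (dotC y x) normCK /t.
  rewrite rmorphM /= fmorphV/= rmorphXn/= (CrealP (normr_real y)).
  by field.
rewrite subr_ge0 ler_pdivrMr ?exprn_gt0// -exprMn.
by rewrite ler_pXn2r// nnegrE ?mulr_ge0.
Qed.

Lemma dotl_continuous z : continuous (dot^~ z : H -> (R[i])^o).
Proof.
move=> x; apply/cvgrPdist_lt => e e0.
have z0 : 0 < `|z| + 1 by rewrite ltr_wpDl.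
near=> y; rewrite -dotBl (le_lt_trans (dot_norm_le _ _))//.
apply: (@le_lt_trans _ _ (`|x - y| * (`|z| + 1))).
  by rewrite ler_wpM2l// lerDl.
rewrite -ltr_pdivlMr//; near: y.
by apply: cvgr_dist_lt; rewrite ?divr_gt0//; exact: cvg_id.
Unshelve. all: by end_near. Qed.

Lemma dotr_continuous z : continuous (dot z : H -> (R[i])^o).
Proof.
move=> x; apply/cvgrPdist_lt => e e0.
have z0 : 0 < `|z| + 1 by rewrite ltr_wpDl.
near=> y; rewrite -dotBr (le_lt_trans (dot_norm_le _ _))//.
apply: (@le_lt_trans _ _ ((`|z| + 1) * `|x - y|)).
  by rewrite ler_wpM2r// lerDl.
rewrite mulrC -ltr_pdivlMr//; near: y.
by apply: cvgr_dist_lt; rewrite ?divr_gt0//; exact: cvg_id.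
Unshelve. all: by end_near. Qed.

(** A maximal orthonormal set, given by Zorn's lemma, is total: a vector
    orthogonal to it could be normalized and added. *)
Lemma orthonormal_basis_exists : exists B, orthonormal_basis dot B.
Proof.
pose P := [set B : set H |
  forall e e', B e -> B e' -> dot e e' = (e == e')%:R].
have [F FP totF|B [PB maxB]] := @Zorn_bigcup _ P.
  move=> e e' [X FX Xe] [Y FY Ye'].
  by have [XY|YX] := totF _ _ FX FY;
    [apply: (FP _ FY) => //; exact: XY|apply: (FP _ FX) => //; exact: YX].
exists B; split=> // x xB; apply/eqP; apply: contrapT => /negP x0.
have nx0 : `|x| != 0 by rewrite normr_eq0.
pose u := `|x|^-1 *: x.
have uu : dot u u = 1.
  by rewrite dotZl dotZr Hdot conj_Creal ?rpredV ?normr_real//; field.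
have uB e : B e -> dot u e = 0 by move=> Be; rewrite dotZl xB// mulr0.
have Bu : dot u u != 0 by rewrite uu oner_eq0.
apply: (maxB (B `|` [set u])).
  split; first exact: subsetUl.
  by move=> /(_ u (or_intror erefl)) /uB; apply/eqP.
move=> e e' [Be|->] [Be'|->]; first exact: PB.
- rewrite dotC uB// conjC0; case: eqP Be => // -> Bu'.
  by move: Bu; rewrite uB// eqxx.
- rewrite uB//; case: eqP Be' => // <- Bu'.
  by move: Bu; rewrite uB// eqxx.
- by rewrite uu eqxx.
Qed.

End inner_product.

Arguments dotl_continuous {R H dot} Hdot z x t _.
Arguments dotr_continuous {R H dot} Hdot z x t _.


(** Bases are unordered, so the sums over a basis are nets indexed by finite
    sets, along the filter generated by the inclusions. *)
Section orthonormal_nets.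
Context (R : realType) (H : completeNormedModType R[i]).
Context (dot : {dot H for Num.conj}) (Hdot : hilbert_product dot).
Context (B : set H) (HB : orthonormal_basis dot B).
Implicit Types (x y z u v : H) (c : H -> R[i]) (s : seq H) (F : {fset H}).

Definition basis_sum c (s : seq H) : H := \sum_(e <- s) c e *: e.

Definition carried_by_basis c := forall e, ~ B e -> c e = 0.

Lemma dot_basis_sum c s e : uniq s -> carried_by_basis c -> B e ->
  dot (basis_sum c s) e = if e \in s then c e else 0.
Proof.
move=> us cB Be; rewrite dot_suml.
under eq_bigr do rewrite dotZl.
have o e' : e' != e -> c e' * dot e' e = 0.
  move=> e'e; have [Be'|/cB->] := pselect (B e'); last by rewrite mul0r.
  by rewrite HB.1// (negbTE e'e) mulr0.
case: ifPn => es.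
  rewrite (bigD1_seq e)//= HB.1// eqxx mulr1 big1 ?addr0//.
rewrite big_seq big1// => e' e's; apply: o; apply: contraNneq es => <- //.
Qed.

Lemma norm_basis_sum c s : uniq s -> carried_by_basis c ->
  `|basis_sum c s| ^+ 2 = \sum_(e <- s) `|c e| ^+ 2.
Proof.
move=> us cB; rewrite -Hdot {2}/basis_sum dot_sumr big_seq [RHS]big_seq.
apply: eq_bigr => e es; rewrite dotZr normCKC.
have [Be|/cB->] := pselect (B e); last by rewrite conjC0 !mul0r.
by rewrite dot_basis_sum// es.
Qed.

Lemma norm_basis_sumB c F G : (F `<=` G)%fset -> carried_by_basis c ->
  `|basis_sum c G - basis_sum c F| ^+ 2 =
  \sum_(e <- G) `|c e| ^+ 2 - \sum_(e <- F) `|c e| ^+ 2.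
Proof.
move=> FG cB.
have GE (V : zmodType) (f : H -> V) :
    \sum_(e <- G) f e = \sum_(e <- F) f e + \sum_(e <- (G `\` F)%fset) f e.
  rewrite (big_fsetID _ (mem F))/=; congr (_ + _); apply: eq_fbigl => e;
    rewrite !inE/=.
    by have [/(fsubsetP FG)|] := boolP (e \in F); rewrite ?andbT ?andbF.
  by rewrite andbC.
rewrite /basis_sum !GE !(addrC (\sum_(e <- F) _)) !addrK.
exact: (norm_basis_sum (fset_uniq _) cB).
Qed.

(** The net is Cauchy: by orthogonality the tail beyond a finite set F has square
    norm equal to the remainder of the bounded sums of squares beyond F. *)
Lemma basis_sum_cvg c (K : R) : carried_by_basis c ->
  (forall F, \sum_(e <- F) `|c e| ^+ 2 <= (K%:C)%C) ->
  cvg ((fun F => basis_sum c F) @ summability.totally).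
Proof.
move=> cB cK; apply: cauchy_cvg; apply: cauchy_exP => e e0.
pose S F : R := complex.Re (\sum_(e <- F) `|c e| ^+ 2).
have SE F : (S F)%:C%C = \sum_(e <- F) `|c e| ^+ 2.
  by rewrite /S RRe_real// realE sumr_ge0.
have Sub : has_sup (range S).
  split; first by exists (S fset0); exists fset0.
  by exists K => _ [F _ <-]; rewrite -lecR SE cK.
have eE : (complex.Re e)%:C%C = e by rewrite RRe_real// gtr0_real.
have e20 : 0 < complex.Re e ^+ 2 by rewrite exprn_gt0// -ltcR eE.
have [_ [F0 _ <-] F0S] := sup_adherent e20 Sub.
exists (basis_sum c F0); exists F0 => // F /= F0F.
rewrite -ball_normE/= -(@ltr_pXn2r _ 2)// ?nnegrE ?(ltW e0)//.
rewrite distrC norm_basis_sumB// -!SE -rmorphB/= -eE -rmorphXn/= ltcR.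
rewrite ltrBlDr -ltrBlDl; apply: le_lt_trans F0S.
by apply: lerB => //; apply: (ub_le_sup Sub.2); exists F.
Qed.

Definition fourier x : H -> R[i] := fun e => if e \in B then dot x e else 0.

Lemma fourier_carried x : carried_by_basis (fourier x).
Proof. by move=> e Be; rewrite /fourier memNset. Qed.

Lemma bessel x F : \sum_(e <- F) `|fourier x e| ^+ 2 <= `|x| ^+ 2.
Proof.
set c := fourier x; pose y := basis_sum c F.
have xy : dot x y = \sum_(e <- F) `|c e| ^+ 2.
  rewrite dot_sumr; apply: eq_bigr => e _; rewrite dotZr normCKC /c /fourier.
  by case: ifP => // _; rewrite conjC0 !mul0r.
have yx : dot y x = \sum_(e <- F) `|c e| ^+ 2.
  by rewrite dotC xy conj_Creal// realE sumr_ge0// => e _; rewrite exprn_ge0.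
have := exprn_ge0 2 (normr_ge0 (x - y)).
rewrite -(Hdot (x - y)) dotBl !dotBr !Hdot xy yx norm_basis_sum//; last 2 first.
- exact: fset_uniq.
- exact: fourier_carried.
by rewrite subrr subr0 subr_ge0.
Qed.

(** The limit exists by Bessel's inequality; it has the same coefficients as x,
    so their difference is orthogonal to the basis. *)
Lemma fourier_expansion x :
  (fun F : {fset H} => basis_sum (fourier x) F) @ summability.totally --> x.
Proof.
have cx := @fourier_carried x.
have Bx F : \sum_(e <- F) `|fourier x e| ^+ 2 <=
    (complex.Re (`|x| ^+ 2))%:C%C.
  by rewrite RRe_real ?realE ?exprn_ge0//; exact: bessel.
have /cvg_ex[/= y xy] := basis_sum_cvg cx Bx.
suff xyE : x = y by rewrite [X in _ --> X]xyE.
apply/eqP; rewrite -subr_eq0; apply/eqP.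
apply: HB.2 => e Be; rewrite dotBl.
apply/eqP; rewrite subr_eq0; apply/eqP.
have : (fun F => dot (basis_sum (fourier x) F) e : (R[i])^o) @ summability.totally
    --> (dot y e : (R[i])^o).
  exact: (cvg_comp _ (dot^~ e) xy (dotl_continuous Hdot e y)).
move=> h; apply: (@cvg_unique _ (@norm_hausdorff _ (R[i])^o) _ _ _ _ _ h).
apply: cvg_near_cst.
exists [fset e]%fset => // F /= eF; rewrite dot_basis_sum//.
  by rewrite (fsubsetP eF) ?inE// /fourier mem_set.
exact: fset_uniq.
Qed.

(** Riesz representation of the functional x |-> <T x, y>, that is, existence of
    T^* y. The representing vector is the sum of the <y, T e> e over the basis,
    whose finite partial sums z satisfy |z|^2 = <y, T z> <= |T| |z| |y|. *)
Lemma bounded_op_riesz (T : H -> H) y : bounded_op T ->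
  exists z, forall x, dot (T x) y = dot x z.
Proof.
move=> [linT [M TM]].
pose TL : {linear H -> H} := HB.pack T (GRing.isLinear.Build _ _ _ _ _ linT).
have TE : T = TL by [].
pose c e := if e \in B then dot y (T e) else 0.
have cB : carried_by_basis c by move=> e Be; rewrite /c memNset.
have M0 : 0 <= ((`|M|)%:C)%C :> R[i] by rewrite ler0c.
have TM' x : `|T x| <= (`|M|)%:C%C * `|x|.
  by rewrite (le_trans (TM x))// ler_wpM2r// lecR ler_norm.
have cK F : \sum_(e <- F) `|c e| ^+ 2 <=
    (`|M| ^+ 2 * complex.Re (`|y| ^+ 2))%:C%C.
  pose z := basis_sum c F.
  have zE : `|z| ^+ 2 = \sum_(e <- F) `|c e| ^+ 2.
    by rewrite norm_basis_sum// fset_uniq.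
  have Tz : dot y (T z) = `|z| ^+ 2.
    rewrite zE TE linear_sum dot_sumr; apply: eq_bigr => e _.
    rewrite linearZ/= dotZr /c; case: ifP => _; first by rewrite normCKC.
    by rewrite conjC0 mul0r normr0 expr0n.
  rewrite -zE rmorphM/= RRe_real ?realE ?exprn_ge0// rmorphXn/= -exprMn.
  rewrite ler_pXn2r ?nnegrE ?mulr_ge0//.
  have [->|z0] := eqVneq z 0; first by rewrite normr0 mulr_ge0.
  rewrite -(@ler_pM2r _ `|z|) ?normr_gt0// -expr2 -Tz.
  have Tzr : dot y (T z) \is Num.real by rewrite Tz realE exprn_ge0.
  apply: (le_trans (real_ler_norm Tzr)).
  by rewrite (le_trans (dot_norm_le Hdot _ _))// mulrAC mulrC ler_wpM2r// TM'.
have /cvg_ex[/= z zc] := basis_sum_cvg cB cK.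
exists z => x.
have xF := @fourier_expansion x.
have h1 : (fun F => dot (T (basis_sum (fourier x) F)) y : (R[i])^o)
    @ summability.totally --> (dot (T x) y : (R[i])^o).
  apply: (@cvg_comp _ _ _ (fun F => T (basis_sum (fourier x) F)) (dot^~ y)
    _ (nbhs (T x))).
    apply/cvgrPdist_lt => e e0.
    have M1 : 0 < (`|M|)%:C%C + 1 :> R[i] by rewrite ltr_wpDl.
    move/cvgrPdist_lt : xF => /(_ (e / ((`|M|)%:C%C + 1))).
    move=> /(_ (divr_gt0 e0 M1)); apply: filterS => F.
    rewrite ltr_pdivlMr// => xF; rewrite TE -linearB -TE.
    apply: (le_lt_trans (TM' _)); apply: le_lt_trans xF.
    by rewrite mulrC ler_wpM2l// lerDl.
  exact: dotl_continuous.
have h2 : (fun F => dot x (basis_sum c F) : (R[i])^o)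
    @ summability.totally --> (dot x z : (R[i])^o).
  exact: (cvg_comp _ (dot x) zc (dotr_continuous Hdot x z)).
apply: (@cvg_unique _ (@norm_hausdorff _ (R[i])^o) _ _ _ _ h1).
rewrite (_ : (fun F => _) =
  (fun F : {fset H} => dot x (basis_sum c F)))//.
apply/funext => F; rewrite TE linear_sum dot_suml dot_sumr.
apply: eq_bigr => e _; rewrite linearZ dotZl dotZr -TE /c /fourier.
case: ifP => _; last by rewrite conjC0 !mul0r.
by rewrite mulrC -dotC.
Qed.

End orthonormal_nets.

Arguments fourier_expansion {R H dot} Hdot {B} HB x t _.

(** * Hilbert-Schmidt operators *)

Lemma esum_le_fsum (R : realType) (T : choiceType) (S : set T) (f : T -> R)
    (K : R) :
  (forall F : {fset T}, (forall x, x \in F -> S x) ->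
    \sum_(x <- F) f x <= K) ->
  (\esum_(x in S) (f x)%:E <= K%:E)%E.
Proof.
move=> fK; apply: ge_ereal_sup => _ [A [finA AS] <-].
rewrite fsbig_finite//= sumEFin lee_fin fK// => x.
by rewrite in_fset_set// inE => /AS.
Qed.

Section parseval.
Context (R : realType) (H : completeNormedModType R[i]).
Context (dot : {dot H for Num.conj}) (Hdot : hilbert_product dot).
Context (B : set H) (HB : orthonormal_basis dot B).
Implicit Types (x y z u v : H).

(** Norms take values in the complex numbers; their squares are read in R in
    order to enter sums and integrals. *)
Definition sqnorm x : R := complex.Re (`|x| ^+ 2).

Lemma sqnormE x : (sqnorm x)%:C%C = `|x| ^+ 2.
Proof. by rewrite /sqnorm RRe_real// realE exprn_ge0. Qed.

Lemma sqnorm_ge0 x : 0 <= sqnorm x.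
Proof. by rewrite -ler0c sqnormE exprn_ge0. Qed.

Definition sqmod (a : R[i]) : R := complex.Re (`|a| ^+ 2).

Lemma sqmodE a : (sqmod a)%:C%C = `|a| ^+ 2.
Proof. by rewrite /sqmod RRe_real// realE exprn_ge0. Qed.

Lemma sqmod_ge0 a : 0 <= sqmod a.
Proof. by rewrite -ler0c sqmodE exprn_ge0. Qed.

Lemma sqmodM a b : sqmod (a * b) = sqmod a * sqmod b.
Proof. by apply: complexI; rewrite rmorphM/= !sqmodE normrM exprMn. Qed.

Lemma sqnormZ a x : sqnorm (a *: x) = sqmod a * sqnorm x.
Proof.
by apply: complexI; rewrite rmorphM/= !sqnormE sqmodE normrZ exprMn.
Qed.

Lemma sqmod_dot_le x y : sqmod (dot x y) <= sqnorm x * sqnorm y.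
Proof.
rewrite -lecR rmorphM/= !sqnormE sqmodE -exprMn ler_pXn2r ?nnegrE ?mulr_ge0//.
exact: dot_norm_le.
Qed.

Lemma sqnorm_le_fourier z (K : R) :
  (forall F : {fset H}, (forall e, e \in F -> B e) ->
     \sum_(e <- F) sqmod (dot z e) <= K) -> sqnorm z <= K.
Proof.
move=> zK; rewrite leNgt; apply/negP => Kz.
have : (fun F : {fset H} => dot (basis_sum (fourier dot B z) F) z : (R[i])^o)
    @ summability.totally --> (dot z z : (R[i])^o).
  exact: (cvg_comp _ (dot^~ z) (fourier_expansion Hdot HB z)
    (dotl_continuous Hdot z z)).
have e0 : 0 < (sqnorm z - K)%:C%C :> R[i] by rewrite (ltcR 0) subr_gt0.
move=> /cvgrPdist_lt /(_ _ e0) [F _ FP]; have {FP} /= := FP F.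
move=> /(_ (fsubset_refl F)).
pose F' := [fset e in F | e \in B]%fset.
have -> : dot (basis_sum (fourier dot B z) F) z =
    (\sum_(e <- F') sqmod (dot z e))%:C%C.
  rewrite dot_suml rmorph_sum/= /F' big_fset/= [RHS]big_mkcond/=.
  apply: eq_bigr => e _; rewrite dotZl /fourier; case: ifP => _; rewrite ?mul0r//.
  by rewrite sqmodE normCK -dotC.
rewrite Hdot -sqnormE -rmorphB/= normc_def/= expr0n addr0 sqrtr_sqr ltcR => h.
have := le_lt_trans (ler_norm _) h; rewrite ltrD2l ltrN2 ltNge zK//.
by move=> e; rewrite !inE/= => /andP[_]; rewrite inE.
Qed.

Lemma esum_parseval x : (\esum_(e in B) (sqmod (dot x e))%:E = (sqnorm x)%:E)%E.
Proof.
apply/eqP; rewrite eq_le; apply/andP; split.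
  apply: esum_le_fsum => F FB; rewrite -lecR sqnormE rmorph_sum/=.
  apply: le_trans (bessel Hdot HB x F); rewrite big_seq [leRHS]big_seq.
  by apply: ler_sum => e eF; rewrite sqmodE /fourier mem_set//; exact: FB.
rewrite leNgt; apply/negP => lt1.
have e0 : (0 <= \esum_(e in B) (sqmod (dot x e))%:E)%E.
  by apply: esum_ge0 => e _; rewrite lee_fin sqmod_ge0.
have fin : (\esum_(e in B) (sqmod (dot x e))%:E)%E \is a fin_num.
  by rewrite ge0_fin_numE// (lt_trans lt1)// ltry.
move: lt1; rewrite -(fineK fin) lte_fin ltNge => /negP; apply.
apply: sqnorm_le_fourier => F FB.
rewrite -lee_fin fineK//; apply: esum_ge; exists [set` F].
  by split; [exact: finite_fset|move=> e /FB].
by rewrite fsbig_finite//= set_fsetK sumEFin.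
Qed.

End parseval.

Section hilbert_schmidt_operators.
Context (R : realType) (H : completeNormedModType R[i]).
Context (dot : {dot H for Num.conj}) (Hdot : hilbert_product dot).
Implicit Types (x y z u v p q : H) (T : H -> H).
Implicit Types (G : (H -> H) -> (H -> H) -> (H -> H)).
Local Notation B := (basis_of_H dot).
Local Notation S2 := (hilbert_schmidt dot).

Lemma basis_of_HP : orthonormal_basis dot B.
Proof.
have [C CB] := orthonormal_basis_exists Hdot.
exact: (xgetPex _ (ex_intro _ C CB)).
Qed.

(** The adjoint is a choice among representing vectors, so this needs that one
    exists. *)
Lemma abs_sq_dot T e : bounded_op T -> dot (abs_sq dot T e) e = `|T e| ^+ 2.
Proof.
move=> bT; rewrite /abs_sq /=; set P := (X in xget 0 X).
have [z Tz] := bounded_op_riesz Hdot basis_of_HP (T e) bT.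
have adjP : P (xget 0 P) by apply: xgetPex; exists z => x _; exact: Tz.
by rewrite dotC -adjP// Hdot conj_Creal// realE exprn_ge0.
Qed.

Lemma pos_trace_abs_sq T : bounded_op T ->
  pos_trace dot (abs_sq dot T) = (\esum_(e in B) (sqnorm (T e))%:E)%E.
Proof. by move=> bT; apply: eq_esum => e _; rewrite abs_sq_dot. Qed.

Lemma hs_norm_finite T (K : R) : bounded_op T -> 0 <= K ->
  (\esum_(e in B) (sqnorm (T e))%:E = K%:E)%E ->
  hs_norm dot T = (Num.sqrt K)%:E.
Proof.
by move=> bT K0 TK; rewrite /hs_norm pos_trace_abs_sq// TK poweR_EFin powR12_sqrt.
Qed.

Lemma hs_norm_ge0 T : (0 <= hs_norm dot T)%E.
Proof. exact: poweR_ge0. Qed.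

(** The operator norm is at most the Hilbert-Schmidt norm: by Parseval's
    identity z = T^* T x satisfies |z| <= |T|_2 |T x|, while
    |T x|^2 = <x, z> <= |x| |z|. *)
Lemma sqnorm_le_hs T x (r : R) : S2 T -> (hs_norm dot T <= r%:E)%E ->
  sqnorm (T x) <= r ^+ 2 * sqnorm x.
Proof.
move=> [bT _] Tr.
have r0 : 0 <= r by rewrite -lee_fin (le_trans _ Tr)// hs_norm_ge0.
set E := (\esum_(e in B) (sqnorm (T e))%:E)%E.
have E0 : (0 <= E)%E by apply: esum_ge0 => e _; rewrite lee_fin sqnorm_ge0.
have Er : (E <= (r ^+ 2)%:E)%E.
  move: Tr; rewrite /hs_norm pos_trace_abs_sq// -/E; move: E0.
  case: E => [k k0|_|//].
    rewrite poweR_EFin powR12_sqrt ?lee_fin// => kr.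
    by rewrite -(sqr_sqrtr k0) ler_pXn2r ?nnegrE// sqrtr_ge0.
  by rewrite poweRyr ?invr_neq0// leye_eq.
have Ter (F : {fset H}) : (forall e, e \in F -> B e) ->
    \sum_(e <- F) sqnorm (T e) <= r ^+ 2.
  move=> FB; rewrite -lee_fin (le_trans _ Er)//; apply: esum_ge; exists [set` F].
    by split; [exact: finite_fset|move=> e /FB].
  by rewrite fsbig_finite//= set_fsetK sumEFin.
(* the coefficient <z, e> is the conjugate of <T e, T x> *)
have [z Tz] := bounded_op_riesz Hdot basis_of_HP (T x) bT.
have zT : sqnorm z <= r ^+ 2 * sqnorm (T x).
  apply: (sqnorm_le_fourier Hdot basis_of_HP) => F FB.
  apply: (@le_trans _ _ ((\sum_(e <- F) sqnorm (T e)) * sqnorm (T x))).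
    rewrite mulr_suml; apply: ler_sum => e _.
    rewrite dotC -Tz; apply: le_trans (sqmod_dot_le Hdot _ _).
    by rewrite -lecR !sqmodE normcJ.
  by rewrite ler_wpM2r ?sqnorm_ge0// Ter.
have := sqmod_dot_le Hdot x z; rewrite -Tz Hdot -sqnormE.
have -> : sqmod (sqnorm (T x))%:C%C = sqnorm (T x) ^+ 2.
  by apply: complexI; rewrite sqmodE !sqnormE rmorphXn/= sqnormE normrX normr_id.
move=> h; have := le_trans h (ler_wpM2l (sqnorm_ge0 x) zT).
have [->|Tx0] := eqVneq (sqnorm (T x)) 0.
  by rewrite mulr_ge0 ?sqnorm_ge0// exprn_ge0.
have Tx_gt0 : 0 < sqnorm (T x) by rewrite lt_neqAle eq_sym Tx0 sqnorm_ge0.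
by rewrite mulrA expr2 ler_pM2r// mulrC.
Qed.

Definition rank1 u v : H -> H := fun h => dot h v *: u.

Lemma rank1_bounded u v : bounded_op (rank1 u v).
Proof.
split; first by move=> a x y; rewrite /rank1 dotDl dotZl scalerDl scalerA.
exists (complex.Re (`|v| * `|u|)) => x.
rewrite RRe_real ?realE ?mulr_ge0// /rank1 normrZ mulrAC.
by rewrite ler_wpM2r// mulrC; exact: dot_norm_le.
Qed.

Lemma hs_norm_rank1 u v :
  hs_norm dot (rank1 u v) = (Num.sqrt (sqnorm u * sqnorm v))%:E.
Proof.
apply: hs_norm_finite; [exact: rank1_bounded|by rewrite mulr_ge0 ?sqnorm_ge0|].
have -> : (fun e => (sqnorm (rank1 u v e))%:E) =
    (fun e => (sqmod (dot ((Num.sqrt (sqnorm u))%:C%C *: v) e))%:E).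
  apply/funext => e; rewrite /rank1 sqnormZ dotZl sqmodM mulrC dotC.
  congr ((_ * _)%:E); last by apply: complexI; rewrite !sqmodE normcJ.
  by apply: complexI; rewrite sqmodE -normrX -rmorphXn/= sqr_sqrtr ?sqnorm_ge0//
    ger0_norm// ler0c sqnorm_ge0.
rewrite (esum_parseval Hdot basis_of_HP) sqnormZ; congr ((_ * _)%:E).
by apply: complexI; rewrite sqmodE -normrX -rmorphXn/= sqr_sqrtr ?sqnorm_ge0//
  ger0_norm// ler0c sqnorm_ge0.
Qed.

Lemma rank1_hs u v : S2 (rank1 u v).
Proof. by split; [exact: rank1_bounded|rewrite hs_norm_rank1 ltry]. Qed.

Lemma rank1Zl a u v : rank1 (a *: u) v = a *: rank1 u v.
Proof.
by apply/funext => h; rewrite /rank1 /= scalerA mulrC -scalerA.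
Qed.

Lemma conj_real_complex (r : R) : (r%:C%C : R[i])^* = r%:C%C.
Proof. exact: conjc_real. Qed.

Lemma rank1Zr a u v : rank1 u (a *: v) = a^* *: rank1 u v.
Proof. by apply/funext => h; rewrite /rank1 /= dotZr -scalerA. Qed.

(** The partial sums of the trace are the products with q of those of the
    expansion of T p. *)
Lemma trace_rank1 T p q : linear T -> trace dot (T \o rank1 p q) = dot (T p) q.
Proof.
move=> linT; apply: (cvg_lim (@norm_hausdorff _ (R[i])^o)).
have := cvg_comp _ (dot^~ q) (fourier_expansion Hdot basis_of_HP (T p))
  (dotl_continuous Hdot q (T p)).
rewrite (_ : _ \o _ = summability.partial_sum (fun e : H =>
  (if e \in B then dot ((T \o rank1 p q) e) e else 0) : (R[i])^o))//.
apply/funext => F /=; rewrite /summability.partial_sum /basis_sum dot_suml.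
rewrite big_seq_fsetE/=; apply: eq_bigr => -[e eF] _ /=.
rewrite dotZl /fourier; case: ifP => _; last by rewrite mul0r.
rewrite /rank1 (linear_scale _ _ linT) dotZl mulrC.
by congr (_ * _); rewrite dotC.
Qed.

Lemma sqnorm0 : sqnorm (0 : H) = 0.
Proof. by apply: complexI; rewrite sqnormE normr0 expr0n. Qed.

Lemma sqnorm_eq0 x : sqnorm x = 0 -> x = 0.
Proof.
move=> x0; apply/eqP; rewrite -normr_eq0 -sqrf_eq0 -sqnormE x0; exact/eqP.
Qed.

Lemma rank10 v : rank1 0 v = 0.
Proof. by apply/funext => h; rewrite /rank1 scaler0. Qed.

Lemma hilbert_schmidt0 : S2 0. Proof. by rewrite -(rank10 0); exact: rank1_hs. Qed.

Lemma bounded_bilinear0l G Y : bounded_bilinear dot G -> S2 Y -> G 0 Y = 0.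
Proof.
move=> [_ Gl _ _] SY; have := Gl (-1) 0 0 Y hilbert_schmidt0 hilbert_schmidt0 SY.
by rewrite !scaleN1r oppr0 addr0 addNr.
Qed.

Lemma bounded_bilinear0r G X : bounded_bilinear dot G -> S2 X -> G X 0 = 0.
Proof.
move=> [_ _ Gr _] SX; have := Gr (-1) X 0 0 SX hilbert_schmidt0 hilbert_schmidt0.
by rewrite !scaleN1r oppr0 addr0 addNr.
Qed.

Lemma bounded_bilinearZl G a X Y : bounded_bilinear dot G -> S2 X -> S2 Y ->
  G (a *: X) Y = a *: G X Y.
Proof.
move=> bG SX SY; have [_ Gl _ _] := bG.
by have := Gl a X 0 Y SX hilbert_schmidt0 SY; rewrite addr0 bounded_bilinear0l// addr0.
Qed.

Lemma bounded_bilinearZr G a X Y : bounded_bilinear dot G -> S2 X -> S2 Y ->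
  G X (a *: Y) = a *: G X Y.
Proof.
move=> bG SX SY; have [_ _ Gr _] := bG.
by have := Gr a X Y 0 SX SY hilbert_schmidt0; rewrite addr0 bounded_bilinear0r// addr0.
Qed.

Lemma sqmod_real (r : R) : sqmod r%:C%C = r ^+ 2.
Proof.
apply: complexI; rewrite sqmodE normc_def/= expr0n addr0 sqrtr_sqr.
by rewrite -rmorphXn/= -normrX ger0_norm// sqr_ge0.
Qed.

(** Zero when u is zero, so that [unitvE] needs no condition. *)
Definition unitv u := ((Num.sqrt (sqnorm u))^-1)%:C%C *: u.

Lemma unitvE u : (Num.sqrt (sqnorm u))%:C%C *: unitv u = u.
Proof.
rewrite /unitv scalerA -rmorphM/=.
have [u0|u0] := eqVneq (sqnorm u) 0.
  by rewrite (sqnorm_eq0 u0) scaler0.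
by rewrite divff ?scale1r// sqrtr_eq0 -ltNge lt_neqAle eq_sym u0 sqnorm_ge0.
Qed.

Lemma sqnorm_unitv u : sqnorm (unitv u) <= 1.
Proof.
rewrite sqnormZ sqmod_real exprVn sqr_sqrtr ?sqnorm_ge0//.
have [->|u0] := eqVneq (sqnorm u) 0; first by rewrite mulr0.
by rewrite mulVf.
Qed.

(** By homogeneity, from the case of unit vectors u, v, w and z; then
    <S p, q> is bounded by the Hilbert-Schmidt norm of S = G(X, Y). *)
Lemma bilinear_norm_rank1 G (M : R) u v w z p q : bounded_bilinear dot G ->
  bilinear_norm dot G = M%:E ->
  sqmod (dot (G (rank1 u v) (rank1 w z) p) q) <=
  M ^+ 2 * (sqnorm u * sqnorm v * (sqnorm w * sqnorm z) * (sqnorm p * sqnorm q)).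
Proof.
move=> bG GM; have [GS _ _ _] := bG.
pose sq x := (Num.sqrt (sqnorm x))%:C%C.
have rE x y : rank1 x y = (sq x * sq y) *: rank1 (unitv x) (unitv y).
  by rewrite -{1}(unitvE x) -{1}(unitvE y) rank1Zl rank1Zr conj_real_complex scalerA.
have r1 x y : (hs_norm dot (rank1 (unitv x) (unitv y)) <= 1)%E.
  rewrite hs_norm_rank1 lee_fin -sqrtr1 ler_wsqrtr// -[leRHS]mulr1.
  by rewrite ler_pM ?sqnorm_ge0// sqnorm_unitv.
have bZ a x y : S2 (a *: rank1 x y) by rewrite -rank1Zl; exact: rank1_hs.
rewrite (rE u v) (rE w z) bounded_bilinearZl ?bounded_bilinearZr//;
  try exact: rank1_hs.
set X := rank1 (unitv u) _; set Y := rank1 (unitv w) _.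
have GXY : (hs_norm dot (G X Y) <= M%:E)%E.
  by rewrite -GM; apply: ereal_sup_ubound; exists (X, Y) => //; split;
    [exact: rank1_hs|exact: rank1_hs|exact: r1|exact: r1].
have SGXY := GS X Y (rank1_hs _ _) (rank1_hs _ _).
rewrite /= -[_ p]/((sq u * sq v) *: ((sq w * sq z) *: G X Y p)).
rewrite !dotZl !sqmodM !sqmod_real !sqr_sqrtr ?sqnorm_ge0//.
rewrite mulrA [leRHS]mulrCA ler_wpM2l ?mulr_ge0 ?sqnorm_ge0//.
apply: le_trans (sqmod_dot_le Hdot _ _) _.
by rewrite mulrA ler_wpM2r ?sqnorm_ge0// sqnorm_le_hs.
Qed.

(** A single elementary tensor, as a series whose other terms vanish through
    their third factor. *)
Lemma rank1_proj_tensor u v w z p q :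
  proj_tensor dot (fun=> rank1 u v) (fun=> rank1 w z)
    (fun n => rank1 (if n == 0%N then p else 0) q).
Proof.
split; first by move=> n; split; exact: rank1_hs.
rewrite (nneseries_split 0 1)//; last first.
  by move=> k _; rewrite !mule_ge0 ?hs_norm_ge0.
rewrite eseries0 ?adde0; last first.
  case=> // k _ _; rewrite /= (hs_norm_rank1 0) sqnorm0 mul0r.
  by rewrite sqrtr0 mule0.
by rewrite add0n big_nat1 !hs_norm_rank1 -!EFinM ltry.
Qed.

Lemma bilinear_pairing_rank1 G u v w z p q : bounded_bilinear dot G ->
  bilinear_pairing dot G (fun=> rank1 u v) (fun=> rank1 w z)
    (fun n => rank1 (if n == 0%N then p else 0) q) =
  dot (G (rank1 u v) (rank1 w z) p) q.
Proof.
move=> bG; have [GS _ _ _] := bG.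
have [[linG _] _] := GS _ _ (rank1_hs u v) (rank1_hs w z).
apply: (cvg_lim (@norm_hausdorff _ (R[i])^o)).
apply: cvg_near_cst; exists 1%N => // n /= n1.
rewrite big_ltn// trace_rank1//= big_nat_cond big1 ?addr0//.
move=> k /andP[/andP[k1 _] _]; rewrite trace_rank1//.
by rewrite gtn_eqF// -(scale0r (0 : H)) (linear_scale _ _ linG) scale0r dot0l.
Qed.

End hilbert_schmidt_operators.

(** * Linear functionals continuous under dominated convergence *)

Section dominated_functionals.
Import HBSimple HBNNSimple.
Context d (T : measurableType d) (R : realType).
Implicit Types (f g : T -> R) (S : set T) (L : (T -> R) -> R).

Definition bounded_measurable f :=
  measurable_fun setT f /\ exists K : R, forall x, `|f x| <= K.

(** The form in which w*-continuity is used: bounded pointwise convergence of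
    sequences implies w*-convergence. Integrals against finite measures share
    this property, and it makes L determined by its values on the indicators of
    a generating family of sets closed under intersection. *)
Definition dominated_functional L :=
  (forall (a : R) f g, bounded_measurable f -> bounded_measurable g ->
     L (fun x => a * f x + g x) = a * L f + L g) /\
  (forall (f_ : nat -> T -> R) f (K : R),
     (forall n, measurable_fun setT (f_ n)) ->
     (forall n x, `|f_ n x| <= K) -> measurable_fun setT f ->
     (forall x, f_ ^~ x @ \oo --> f x) ->
     L \o f_ @ \oo --> L f).

Lemma bounded_measurable_indic S : measurable S -> bounded_measurable (\1_S).
Proof.
move=> mS; split; first exact: measurable_indic.
by exists 1 => x; rewrite indicE ger0_norm// lern1 leq_b1.
Qed.

Lemma bounded_measurable_cst (r : R) : bounded_measurable (fun=> r).
Proof. by split; [exact: measurable_cst|exists `|r|]. Qed.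

Lemma bounded_measurable_lin a f g : bounded_measurable f ->
  bounded_measurable g -> bounded_measurable (fun x => a * f x + g x).
Proof.
move=> [mf [K fK]] [mg [M gM]]; split.
  by apply: measurable_funD => //; exact: measurable_funM.
exists (`|a| * K + M) => x; rewrite (le_trans (ler_normD _ _))//.
by rewrite lerD// normrM ler_wpM2l.
Qed.

Lemma bounded_measurable_mul f g : bounded_measurable f ->
  bounded_measurable g -> bounded_measurable (fun x => f x * g x).
Proof.
move=> [mf [K fK]] [mg [M gM]]; split; first exact: measurable_funM.
by exists (K * M) => x; rewrite normrM ler_pM.
Qed.

Lemma bounded_measurable_sum I (r : seq I) (P : pred I) (F : I -> T -> R) :
  (forall i, bounded_measurable (F i)) ->
  bounded_measurable (fun x => \sum_(i <- r | P i) F i x).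
Proof.
move=> bF; elim: r => [|j r IH].
  rewrite (_ : (fun x => _) = fun=> 0); first exact: bounded_measurable_cst.
  by apply/funext => x; rewrite big_nil.
have [Pj|Pj] := boolP (P j); last first.
  by under eq_fun do rewrite big_cons (negbTE Pj).
under eq_fun do rewrite big_cons Pj -[F j _]mul1r.
exact: bounded_measurable_lin.
Qed.

Lemma bounded_measurable_lim (f_ : nat -> T -> R) f (K : R) :
  (forall n x, `|f_ n x| <= K) -> measurable_fun setT f ->
  (forall x, f_ ^~ x @ \oo --> f x) -> bounded_measurable f.
Proof.
move=> fK mf ff; split=> //; exists K => x; have h := cvg_norm (ff x).
rewrite -(cvg_lim (@Rhausdorff R) (h _)); apply: limr_le.
  by apply/cvg_ex; exists `|f x|; exact: h.
by apply: nearW => n; exact: fK.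
Qed.

Lemma dominated_functional0 L : dominated_functional L -> L (fun=> 0) = 0.
Proof.
move=> [linL _]; have := linL 1 (fun=> 0) (fun=> 0) (bounded_measurable_cst 0)
  (bounded_measurable_cst 0).
rewrite [X in L X](_ : _ = fun=> 0); last by apply/funext => x; rewrite mulr0 addr0.
by rewrite mul1r => /eqP; rewrite addrC -subr_eq subrr eq_sym => /eqP.
Qed.

Lemma dominated_functionalZ L a f : dominated_functional L ->
  bounded_measurable f -> L (fun x => a * f x) = a * L f.
Proof.
move=> dL bf; rewrite -[RHS]addr0 -(dominated_functional0 dL) -dL.1//.
  by congr L; apply/funext => x; rewrite addr0.
exact: bounded_measurable_cst.
Qed.

Lemma dominated_functionalD L f g : dominated_functional L ->
  bounded_measurable f -> bounded_measurable g ->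
  L (fun x => f x + g x) = L f + L g.
Proof.
move=> dL bf bg; rewrite -[L f in RHS]mul1r -dL.1//.
by congr L; apply/funext => x; rewrite mul1r.
Qed.

Lemma dominated_functional_cst0 : dominated_functional (fun=> 0).
Proof. by split=> *; [rewrite mulr0 addr0|exact: cvg_cst]. Qed.

Lemma dominated_functionalB L1 L2 : dominated_functional L1 ->
  dominated_functional L2 -> dominated_functional (fun f => L1 f - L2 f).
Proof.
move=> [l1 c1] [l2 c2]; split=> [a f g bf bg|f_ f K mf_ fK mf ff].
  by rewrite l1// l2//; ring.
by apply: cvgB; [exact: (c1 _ _ K)|exact: (c2 _ _ K)].
Qed.

Lemma dominated_functional_restrict L h : dominated_functional L ->
  bounded_measurable h -> dominated_functional (fun f => L (fun x => h x * f x)).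
Proof.
move=> [lL cL] bh; split=> [a f g bf bg|f_ f K mf_ fK mf ff].
  rewrite -lL; [|exact: bounded_measurable_mul..].
  by congr L; apply/funext => x; ring.
have [mh [M hM]] := bh.
apply: (cL _ _ (M * K)) => [n|n x||x]; first exact: measurable_funM.
- by rewrite normrM ler_pM.
- exact: measurable_funM.
- by apply: cvgM => //; exact: cvg_cst.
Qed.

Lemma dominated_functional_sum L I (r : seq I) (P : pred I) (F : I -> T -> R) :
  dominated_functional L -> (forall i, bounded_measurable (F i)) ->
  L (fun x => \sum_(i <- r | P i) F i x) = \sum_(i <- r | P i) L (F i).
Proof.
move=> dL bF; elim: r => [|i r IH].
  rewrite big_nil -[RHS](dominated_functional0 dL); congr L.
  by apply/funext => x; rewrite big_nil.
rewrite big_cons; case: (boolP (P i)) => Pi; last first.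
  by rewrite -IH; congr L; apply/funext => x; rewrite big_cons (negbTE Pi).
rewrite -IH -dominated_functionalD//.
  by congr L; apply/funext => x; rewrite big_cons Pi.
exact: bounded_measurable_sum.
Qed.

Lemma lim_cst0_eq0 (l : R) : (fun _ : nat => 0 : R) @ \oo --> l -> l = 0.
Proof. by move=> h; rewrite -(cvg_lim (@Rhausdorff R) h) lim_cst. Qed.

(** A nonnegative bounded function is a bounded increasing limit of simple
    functions; a bounded one becomes nonnegative after adding a constant. *)
Lemma dominated_functional_indic0 L f : dominated_functional L ->
  (forall S, measurable S -> L (\1_S) = 0) -> bounded_measurable f -> L f = 0.
Proof.
move=> dL L0.
wlog f0 : f / forall x, 0 <= f x => [nn bf|bf].
  have [_ [K fK]] := bf; pose g x := K * 1 + f x.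
  have bg : bounded_measurable g.
    by apply: bounded_measurable_lin => //; exact: bounded_measurable_cst.
  have : L g = 0.
    apply: nn => // x; rewrite /g mulr1 -lerBlDl sub0r.
    by rewrite lerNl (le_trans (ler_norm _))// normrN.
  rewrite /g dL.1//; last exact: bounded_measurable_cst.
  rewrite (_ : (fun=> 1) = \1_[set: T]) ?L0 ?mulr0 ?add0r//.
  by apply/funext => x; rewrite indicT.
have [mf [K fK]] := bf.
have mfE : measurable_fun setT (EFin \o f) by exact/measurable_EFinP.
pose g n : T -> R := nnsfun_approx measurableT mfE n.
have gf x : g ^~ x @ \oo --> f x.
  apply: (@fine_cvg _ _ _ _ (EFin \o (g ^~ x))).
  by apply: (cvg_nnsfun_approx measurableT mfE) => // y _ /=; rewrite lee_fin.
have ndg x : nondecreasing_seq (g ^~ x).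
  by move=> n m nm; exact/lefP/nd_nnsfun_approx.
have gle n x : g n x <= f x.
  rewrite -(cvg_lim _ (gf x))//.
  apply: (nondecreasing_cvgn_le (ndg x)).
  by apply/cvg_ex; exists (f x); exact: gf.
have g0 n x : 0 <= g n x by rewrite /g.
have Lg n : L (g n) = 0.
  have gE : g n = fun x => \sum_(y <- fset_set (range (g n)))
      y * \1_(g n @^-1` [set y]) x.
    by apply/funext => x; rewrite {1}/g fimfunE fsbig_finite.
  have m1 y : bounded_measurable (\1_(g n @^-1` [set y])).
    by apply: bounded_measurable_indic; exact: measurable_sfunP.
  rewrite gE dominated_functional_sum// ?big1// => y.
    by move=> _; rewrite dominated_functionalZ// L0 ?mulr0//;
      exact: measurable_sfunP.
  by apply: bounded_measurable_mul => //; exact: bounded_measurable_cst.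
have := dL.2 g f K.
rewrite (_ : L \o g = fun=> 0); last by apply/funext => n; exact: Lg.
move=> Lgf; apply: lim_cst0_eq0; apply: Lgf => // n x; rewrite ger0_norm// (le_trans (gle n x))//.
by rewrite (le_trans (ler_norm _)).
Qed.

Lemma eq_dominated_functional L1 L2 f : dominated_functional L1 ->
  dominated_functional L2 ->
  (forall S, measurable S -> L1 (\1_S) = L2 (\1_S)) ->
  bounded_measurable f -> L1 f = L2 f.
Proof.
move=> d1 d2 L12 bf; apply/eqP; rewrite -subr_eq0; apply/eqP.
apply: (dominated_functional_indic0 (dominated_functionalB d1 d2)) => //.
by move=> S mS; rewrite L12// subrr.
Qed.

(** Dynkin's argument: the sets whose indicator is killed by L are closed under
    complements by linearity, and under countable disjoint unions by
    continuity. *)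
Lemma dominated_functional_pi L (G : set (set T)) : dominated_functional L ->
  @measurable _ T = <<s G >> -> setI_closed G -> G setT ->
  (forall S, G S -> L (\1_S) = 0) -> forall S, measurable S -> L (\1_S) = 0.
Proof.
move=> dL GE GI GT LG S; rewrite GE.
apply: (dynkin_induction (P := [set S | L (\1_S) = 0]) GE GI) => /=.
- exact: LG.
- exact: LG.
- move=> A mA LA.
  have -> : \1_(~` A) = (fun x => -1 * \1_A x + \1_[set: T] x) :> (T -> R).
    by apply/funext => x; rewrite !indicE in_setC in_setT; case: (x \in A) => /=; ring.
  by rewrite dL.1 ?LA ?LG ?mulr0 ?addr0//; exact: bounded_measurable_indic.
move=> F mF tF LF.
pose s n : T -> R := fun x => \sum_(i < n) \1_(F i) x.
have sE n : s n = \1_(\big[setU/set0]_(i < n) F i).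
  apply/funext => x; rewrite /s; elim: n => [|n IH].
    by rewrite !big_ord0 indic0.
  rewrite !big_ord_recr/= IH !indicE in_setU.
  have [|] := boolP (x \in F n); last by rewrite orbF addr0.
  have [|] := boolP (x \in \big[setU/set0]_(i < n) F i); last by rewrite add0r.
  rewrite !inE -bigcup_mkord => -[k /= kn Fkx] Fnx.
  have /eqP := tF k n I I (ex_intro _ x (conj Fkx Fnx)).
  by rewrite ltn_eqF.
have Ls : L \o s = fun=> 0.
  apply/funext => n /=; rewrite dominated_functional_sum//.
    by rewrite big1.
  by move=> i; exact: bounded_measurable_indic.
have := dL.2 s (\1_(\bigcup_k F k)) 1; rewrite Ls => h.
have ms n : measurable_fun setT (s n).
  by rewrite sE; apply: measurable_indic; exact: bigsetU_measurable.
apply: lim_cst0_eq0; apply: h => //.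
- by move=> n x; rewrite sE indicE ger0_norm// lern1 leq_b1.
- by apply: measurable_indic; exact: bigcup_measurable.
move=> x; apply: cvg_near_cst.
have [[k _ Fkx]|nFx] := pselect ((\bigcup_k F k) x).
  exists k.+1 => // n /= kn; rewrite sE !indicE !mem_set//; first by exists k.
  by rewrite -bigcup_mkord; exists k.
exists 0%N => // n _; rewrite sE !indicE !memNset//.
by rewrite -bigcup_mkord => -[k _ Fkx]; apply: nFx; exists k.
Qed.

End dominated_functionals.

(** * Boxes in a product of three spaces *)

Section boxes.
Context d1 d2 d3 (T1 : measurableType d1) (T2 : measurableType d2)
  (T3 : measurableType d3) (R : realType).
Local Notation T := (T1 * T2 * T3)%type.

Definition box (A1 : set T1) (A2 : set T2) (A3 : set T3) : set T :=
  (A1 `*` A2) `*` A3.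

Definition boxes : set (set T) := [set A | exists A1 A2 A3,
  [/\ measurable A1, measurable A2, measurable A3 & A = box A1 A2 A3]].

Lemma measurable_box A1 A2 A3 : measurable A1 -> measurable A2 ->
  measurable A3 -> measurable (box A1 A2 A3).
Proof. by move=> m1 m2 m3; do 2?apply: measurableX. Qed.

Lemma box_setI A1 A2 A3 B1 B2 B3 : box A1 A2 A3 `&` box B1 B2 B3 =
  box (A1 `&` B1) (A2 `&` B2) (A3 `&` B3).
Proof. by rewrite /box !setXI. Qed.

Lemma boxes_setI_closed : setI_closed boxes.
Proof.
move=> _ _ [A1 [A2 [A3 [mA1 mA2 mA3 ->]]]] [B1 [B2 [B3 [mB1 mB2 mB3 ->]]]].
exists (A1 `&` B1), (A2 `&` B2), (A3 `&` B3).
by split; rewrite ?/box -?setXI//; exact: measurableI.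
Qed.

Lemma boxesT : boxes setT.
Proof. by exists setT, setT, setT; split => //; rewrite /box !setXTT. Qed.

(** A third side is fixed first: the sets A12 with A12 x A3 in D form a
    sigma-algebra, which contains all A1 x A2. *)
Lemma sigma_algebra_boxes (D : set (set T)) : sigma_algebra setT D ->
  boxes `<=` D -> forall S : set T, measurable S -> D S.
Proof.
move=> sD bD S; rewrite measurable_prod_measurableType.
move: S; apply: smallest_sub => // _ [A12 mA12 [A3 mA3 <-]].
have [D0 DC DU] := sD.
move: A12 mA12; rewrite measurable_prod_measurableType.
suff: <<s [set A `*` B | A in measurable & B in measurable] >> `<=`
    [set A12 : set (T1 * T2) | D (A12 `*` A3)] by move=> + A12 sA12; exact.
apply: smallest_sub; last first.
  by move=> _ [A1 mA1 [A2 mA2 <-]]; apply: bD; exists A1, A2, A3.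
split => [|A DA|F DF] /=; first by rewrite set0X.
  have -> : (setT `\` A) `*` A3 = setT `\` ((A `*` A3) `|` (setT `\` (setT `*` A3))).
    apply/seteqP; split => -[x y] /=.
      by move=> [[_ nA] Ay]; split => // -[[//]|[_]]; apply.
    move=> [_ /not_orP[nA /not_andP[//|/contrapT[_ Ay]]]].
    by split=> //; split=> // Ax; apply: nA.
  apply: (DC); rewrite -bigcup2E; apply: (DU) => -[//|[|//]] /=.
    apply: (DC); apply: bD; exists setT, setT, A3.
    by split => //; rewrite /box setXTT.
by rewrite setX_bigcupl; exact: DU.
Qed.

Lemma measurable_boxesE : @measurable _ T = <<s boxes >>.
Proof.
apply/seteqP; split.
  apply: sigma_algebra_boxes; first exact: smallest_sigma_algebra.
  exact: sub_sigma_algebra.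
apply: smallest_sub; first exact: sigma_algebra_measurable.
by move=> _ [A1 [A2 [A3 [m1 m2 m3 ->]]]]; exact: measurable_box.
Qed.

Lemma dominated_functional_boxes (L1 L2 : (T -> R) -> R) f :
  dominated_functional L1 -> dominated_functional L2 ->
  (forall A1 A2 A3, measurable A1 -> measurable A2 -> measurable A3 ->
     L1 (\1_(box A1 A2 A3)) = L2 (\1_(box A1 A2 A3))) ->
  bounded_measurable f -> L1 f = L2 f.
Proof.
move=> d1' d2' L12 bf; apply: eq_dominated_functional => // S mS.
apply/eqP; rewrite -subr_eq0; apply/eqP; move: S mS.
apply: (dominated_functional_pi (dominated_functionalB d1' d2')
  measurable_boxesE boxes_setI_closed boxesT).
by move=> _ [A1 [A2 [A3 [m1 m2 m3 ->]]]]; rewrite L12// subrr.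
Qed.

(** The algebra generated by the boxes. Membership of (x, y, z) is decided by z
    once the class of x in a finite measurable partition of T1 and that of y in
    one of T2 are known; with this description complements are immediate, and a
    member is visibly a finite disjoint union of boxes. *)
Definition grid : set (set T) := [set S | exists (I J : finType)
  (f : T1 -> I) (g : T2 -> J) (B : I -> J -> set T3),
  [/\ forall i, measurable (f @^-1` [set i]),
      forall j, measurable (g @^-1` [set j]),
      forall i j, measurable (B i j) &
      S = [set x | B (f x.1.1) (g x.1.2) x.2]]].

Lemma grid_setring : setring grid.
Proof.
have grid2 (op : Prop -> Prop -> Prop) :
    (forall U V : set T3, measurable U -> measurable V ->
      measurable [set x | op (U x) (V x)]) ->
    forall S S', grid S -> grid S' -> grid [set x | op (S x) (S' x)].
  move=> mop _ _ [I [J [f [g [B [mf mg mB ->]]]]]]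
    [I' [J' [f' [g' [B' [mf' mg' mB' ->]]]]]].
  exists (I * I')%type, (J * J')%type, (fun x => (f x, f' x)),
    (fun x => (g x, g' x)), (fun i j => [set x | op (B i.1 j.1 x) (B' i.2 j.2 x)]).
  split=> //= [[i i']|[j j']|i j]; last exact: mop.
    rewrite (_ : _ @^-1` _ = f @^-1` [set i] `&` f' @^-1` [set i']).
      exact: measurableI.
    by apply/seteqP; split => x /= [-> ->].
  rewrite (_ : _ @^-1` _ = g @^-1` [set j] `&` g' @^-1` [set j']).
    exact: measurableI.
  by apply/seteqP; split => x /= [-> ->].
split.
- exists unit, unit, (fun=> tt), (fun=> tt), (fun _ _ => set0).
  by split => // i; rewrite (_ : _ @^-1` _ = setT)//; apply/seteqP; split => // x _; case: i.
- by apply: (grid2 or) => U V mU mV; exact: measurableU.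
- by apply: (grid2 (fun p q => p /\ ~ q)) => U V mU mV; exact: measurableD.
Qed.

Lemma preimage_mem (U : Type) (A : set U) (i : bool) :
  (fun x => x \in A) @^-1` [set i] = if i then A else ~` A.
Proof.
case: i; apply/seteqP; split=> x /=.
- by move/set_mem.
- exact: mem_set.
- by move=> xA Ax; rewrite mem_set in xA.
- exact: memNset.
Qed.

Lemma boxes_grid : boxes `<=` grid.
Proof.
move=> _ [A1 [A2 [A3 [m1 m2 m3 ->]]]].
exists bool, bool, (fun x => x \in A1), (fun x => x \in A2),
  (fun i j => if i && j then A3 else set0); split.
- by move=> i; rewrite preimage_mem; case: i => //; exact: measurableC.
- by move=> i; rewrite preimage_mem; case: i => //; exact: measurableC.
- by move=> i j; case: ifP.
apply/seteqP; split=> -[[x y] z] /=.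
  by move=> [[Ax Ay] Az]; rewrite !mem_set.
by case: ifPn => // /andP[]; rewrite !inE.
Qed.

(** Positivity passes from the boxes to the algebra of their finite disjoint
    unions by additivity, then to all measurable sets by the monotone class
    theorem. As it does not pass to complements, Dynkin systems would not do. *)
Lemma ge0_on_boxes (L : (T -> R) -> R) : dominated_functional L ->
  (forall A1 A2 A3, measurable A1 -> measurable A2 -> measurable A3 ->
     0 <= L (\1_(box A1 A2 A3))) ->
  forall S, measurable S -> 0 <= L (\1_S).
Proof.
move=> dL L0.
pose G := [set S : set T | measurable S /\ 0 <= L (\1_S)].
have gridG : grid `<=` G.
  move=> S [I [J [f [g [B [mf mg mB ->]]]]]].
  pose b (ij : I * J) := box (f @^-1` [set ij.1]) (g @^-1` [set ij.2]) (B ij.1 ij.2).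
  have mb ij : measurable (b ij) by exact: measurable_box.
  have SE : [set x | B (f x.1.1) (g x.1.2) x.2] = \bigcup_(ij in setT) b ij.
    apply/seteqP; split => -[[x y] z] /=; first by move=> Bz; exists (f x, g y).
    by move=> [[i j] _ [[/= -> ->]]].
  split.
    by rewrite SE; apply: fin_bigcup_measurable => //; exact: finite_finset.
  have -> : \1_[set x | B (f x.1.1) (g x.1.2) x.2] =
      (fun x => \sum_ij \1_(b ij) x) :> (T -> R).
    apply/funext => -[[x y] z]; rewrite (bigD1 (f x, g y))//= big1 ?addr0.
      rewrite !indicE; congr (nat_of_bool _)%:R.
      by apply/idP/idP => /set_mem h; apply/mem_set; [split|case: h].
    move=> [i j] ij; rewrite indicE memNset// => -[[/= fx gy] _].
    by move: ij; rewrite fx gy eqxx.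
  rewrite dominated_functional_sum//; first by apply: sumr_ge0 => ij _; exact: L0.
  by move=> ij; exact: bounded_measurable_indic.
have cvgG (F : nat -> set T) S : (forall n, G (F n)) -> measurable S ->
    (forall x, (\1_(F n) x : R) @[n --> \oo] --> (\1_S x : R)) -> G S.
  move=> GF mS FS; split => //.
  have Lc : L \o (fun n => \1_(F n)) @ \oo --> L (\1_S).
    apply: (dL.2 _ _ 1) => // [n|n x].
      by apply: measurable_indic; have [] := GF n.
    by rewrite indicE ger0_norm// lern1 leq_b1.
  rewrite -(cvg_lim (@Rhausdorff R) Lc); apply: limr_ge.
    by apply/cvg_ex; exists (L \1_S).
  by apply: nearW => n; have [] := GF n.
have monG : monotone G.
  split=> F mF GF.
    apply: (cvgG F) => //; first by apply: bigcup_measurable => n _; have [] := GF n.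
    move=> x; apply: cvg_near_cst.
    have [[k _ Fkx]|nFx] := pselect ((\bigcup_k F k) x).
      exists k => // n /= kn; rewrite !indicE !mem_set//; first by exists k.
      by have /subsetPset := mF _ _ kn; exact.
    exists 0%N => // n _; rewrite !indicE !memNset//.
    by move=> Fnx; apply: nFx; exists n.
  apply: (cvgG F) => //.
    by apply: bigcapT_measurable => n; have [] := GF n.
  move=> x; apply: cvg_near_cst.
  have [aFx|/existsNP[k nFx]] := pselect (forall k, F k x).
    by exists 0%N => // n _; rewrite !indicE !mem_set.
  exists k => // n /= kn; rewrite !indicE !memNset//.
    by move=> aF; apply: nFx; exact: aF.
  by have /subsetPset := mF _ _ kn; move=> FF /FF.
have sr : sigma_algebra setT <<sr grid >>.
  have [s0 sD sU] := smallest_sigma_ring grid; split => // A sA.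
  apply: sD => //; apply: sub_g_sigma_ring; exact/boxes_grid/boxesT.
move=> S mS; suff : G S by case.
apply: (monotone_setring_sub_g_sigma_ring monG grid_setring gridG).
apply: sigma_algebra_boxes mS => //.
by move=> A /boxes_grid; exact: sub_g_sigma_ring.
Qed.

End boxes.

(** * Integrals and null sets *)

Section integral_functional.
Context d (T : measurableType d) (R : realType).
Variable mu : {measure set T -> \bar R}.
Hypothesis mu_fin : (mu setT < +oo)%E.
Implicit Types (f : T -> R).

Lemma bounded_measurable_integrable f : bounded_measurable f ->
  mu.-integrable setT (EFin \o f).
Proof.
move=> [mf [K fK]]; apply: measurable_bounded_integrable => //.
exists K; split; first exact: num_real.
by move=> M KM x _ /=; rewrite (le_trans (fK x))// ltW.
Qed.

Lemma Rintegral_dominated : dominated_functional (Rintegral mu setT).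
Proof.
split=> [a f g bf bg|f_ f K mf_ fK mf ff].
  rewrite RintegralD//; last 2 first.
  - apply: bounded_measurable_integrable.
    by apply: bounded_measurable_mul => //; exact: bounded_measurable_cst.
  - exact: bounded_measurable_integrable.
  by rewrite RintegralZl//; exact: bounded_measurable_integrable.
have bf := bounded_measurable_lim fK mf ff.
have bK := bounded_measurable_integrable (bounded_measurable_cst T K).
have [] := @dominated_convergence _ _ _ mu setT measurableT
  (fun n => EFin \o f_ n) (EFin \o f) (EFin \o (fun=> K)).
- by move=> n; exact/measurable_EFinP.
- exact/measurable_EFinP.
- by apply/aeW => x _; apply/cvg_EFin; [exact: nearW|exact: ff].
- exact: bK.
- by apply/aeW => x n _ /=; rewrite lee_fin.
move=> _ _ h; apply: (@fine_cvg _ _ _ _ (fun n => \int[mu]_(x in setT) (f_ n x)%:E)%E).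
rewrite /Rintegral fineK//; apply: integrable_fin_num => //.
exact: bounded_measurable_integrable.
Qed.

End integral_functional.

Section null_sets.
Context (R : realType).

(** Absolute continuity with respect to a family of measures. *)
Definition dominated_by_family d (T : measurableType d) (I : Type)
    (m : I -> set T -> \bar R) (l : set T -> \bar R) :=
  forall S, measurable S -> (forall i, m i S = 0%E) -> l S = 0%E.

Lemma ae_forall_count d (T : measurableType d) (I : countType)
    (mu : {measure set T -> \bar R}) (P : I -> T -> Prop) :
  (forall i, \forall x \ae mu, P i x) -> \forall x \ae mu, forall i, P i x.
Proof.
move=> aeP; pose Q n x := if choice.unpickle n is Some i then P i x else True.
have : \forall x \ae mu, forall n, Q n x.
  by apply: ae_foralln => n; rewrite /Q; case: choice.unpickle => [i|]; [exact: aeP|exact: aeW].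
by apply: filterS => x Qx i; have := Qx (choice.pickle i); rewrite /Q choice.pickleK.
Qed.

Lemma null_integral_family d (T : measurableType d) (I : countType)
    (mu : {measure set T -> \bar R}) (f : I -> T -> \bar R) (g : T -> \bar R) :
  (forall i, measurable_fun setT (f i)) -> measurable_fun setT g ->
  (forall i x, 0 <= f i x)%E ->
  (forall i, \int[mu]_x f i x = 0)%E ->
  (forall x, (forall i, f i x = 0) -> g x = 0)%E ->
  (\int[mu]_x g x = 0)%E.
Proof.
move=> mf mg f0 If fg.
have fae i : \forall x \ae mu, f i x = 0%E.
  have : (\int[mu]_x `|f i x| = 0)%E.
    by rewrite -[RHS](If i); apply: eq_integral => x _; rewrite gee0_abs.
  move=> /(ae_eq_integral_abs mu measurableT (mf i)).
  by apply: filterS => x; exact.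
rewrite (ae_eq_integral (cst 0%E))//; first exact: integral0.
by apply: filterS (ae_forall_count fae) => x /fg.
Qed.

Lemma product_measure12 d1 d2 (T1 : measurableType d1) (T2 : measurableType d2)
    (m1 : {sigma_finite_measure set T1 -> \bar R})
    (m2 : {sigma_finite_measure set T2 -> \bar R}) (N : set (T1 * T2)) :
  measurable N -> (m1 \x m2)%E N = (m1 \x^ m2)%E N.
Proof.
pose m' : {measure set (T1 * T2) -> \bar R} := (m1 \x^ m2)%E.
move=> mN; apply: (@product_measure_unique _ _ _ _ _ m1 m2 m') => //.
by move=> A B mA mB; exact: product_measure2E.
Qed.

Section finite_product.
Context d1 d2 (T1 : measurableType d1) (T2 : measurableType d2).
Variables (m1 : {finite_measure set T1 -> \bar R})
  (m2 : {finite_measure set T2 -> \bar R}).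

(** The product of finite measures, packed as a finite measure in order to be
    multiplied again. *)
Definition finite_product : set (T1 * T2) -> \bar R := (m1 \x m2)%E.

HB.instance Definition _ := Measure.on finite_product.

Let finite_product_fin : fin_num_fun finite_product.
Proof.
apply: lty_fin_num_fun.
rewrite -setXTT [ltLHS]product_measure1E//.
by rewrite lte_mul_pinfty// ?fin_num_measure// -ge0_fin_numE// fin_num_measure.
Qed.

HB.instance Definition _ :=
  Measure_isFinite.Build _ _ _ finite_product finite_product_fin.

End finite_product.

(** Fubini's theorem, one factor at a time: as J is countable, almost every
    section is null for all the m2 j at once, hence for l2; and likewise on the
    left. *)
Lemma dominated_by_family_prod d1 d2 (T1 : measurableType d1)
    (T2 : measurableType d2) (I J : countType)
    (m1 : I -> {sigma_finite_measure set T1 -> \bar R})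
    (l1 : {sigma_finite_measure set T1 -> \bar R})
    (m2 : J -> {sigma_finite_measure set T2 -> \bar R})
    (l2 : {sigma_finite_measure set T2 -> \bar R}) :
  dominated_by_family m1 l1 -> dominated_by_family m2 l2 ->
  dominated_by_family (fun ij : I * J => (m1 ij.1 \x m2 ij.2)%E) (l1 \x l2)%E.
Proof.
move=> m1l1 m2l2 N mN N0.
rewrite product_measure12//.
apply: (null_integral_family (f := fun i => m1 i \o ysection N)) => [i||i x|i|y].
- exact: measurable_fun_ysection.
- exact: measurable_fun_ysection.
- exact: measure_ge0.
- rewrite -[LHS]/((m1 i \x^ l2)%E N) -product_measure12//.
  apply: (null_integral_family (f := fun j => m2 j \o xsection N)) => [j||j x|j|x].
  + exact: measurable_fun_xsection.
  + exact: measurable_fun_xsection.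
  + exact: measure_ge0.
  + exact: (N0 (i, j)).
  + by apply: m2l2; exact: measurable_xsection.
- by apply: m1l1; exact: measurable_ysection.
Qed.

End null_sets.

(** * Measurability and convergence of complex functions *)

Section complex_measurability.
Context (R : realType).

Lemma normc_real (r : R) : Normc.normc r%:C%C = `|r|.
Proof. by rewrite /= expr0n addr0 sqrtr_sqr. Qed.

Lemma norm_normc (z : R[i]) : `|z| = (Normc.normc z)%:C%C.
Proof. by []. Qed.

Lemma normc_ge0 (z : R[i]) : 0 <= Normc.normc z.
Proof. by rewrite -ler0c -norm_normc. Qed.

Lemma Re_le_normc (z : R[i]) : `|complex.Re z| <= Normc.normc z.
Proof. by rewrite -lecR -norm_normc normc_ge_Re. Qed.

Lemma Im_le_normc (z : R[i]) : `|complex.Im z| <= Normc.normc z.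
Proof.
case: z => a b /=; rewrite -sqrtr_sqr ler_wsqrtr// lerDr sqr_ge0//.
Qed.

Lemma normc_le_ReIm (a b : R) : Normc.normc (a +i* b)%C <= `|a| + `|b|.
Proof.
rewrite /= -[leRHS]ger0_norm ?addr_ge0// -sqrtr_sqr ler_wsqrtr//.
by rewrite sqrrD !real_normK ?num_real// -addrA lerD2l lerDr mulrn_wge0// mulr_ge0.
Qed.

Lemma Re_continuous : continuous (@complex.Re R : (R[i])^o -> R).
Proof.
move=> z; apply/(@cvgrPdist_lt _ _ _ _ (nbhs_filter (z : (R[i])^o))) => e e0.
exists (e%:C)%C; rewrite /= ?ltcR// => w zw.
have {}zw : Normc.normc (z - w) < e by rewrite -ltcR; exact: zw.
by rewrite -raddfB; exact: le_lt_trans (Re_le_normc _) zw.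
Qed.

Lemma Im_continuous : continuous (@complex.Im R : (R[i])^o -> R).
Proof.
move=> z; apply/(@cvgrPdist_lt _ _ _ _ (nbhs_filter (z : (R[i])^o))) => e e0.
exists (e%:C)%C; rewrite /= ?ltcR// => w zw.
have {}zw : Normc.normc (z - w) < e by rewrite -ltcR; exact: zw.
by rewrite -raddfB; exact: le_lt_trans (Im_le_normc _) zw.
Qed.

Lemma normc_sub_le (z w : R[i]) :
  Normc.normc z - Normc.normc w <= Normc.normc (z - w).
Proof. by rewrite lerBlDr (le_trans _ (le_normcD _ _))// subrK. Qed.

Lemma normc_continuous : continuous (@Normc.normc R : (R[i])^o -> R).
Proof.
move=> z; apply/(@cvgrPdist_lt _ _ _ _ (nbhs_filter (z : (R[i])^o))) => e e0.
exists (e%:C)%C; rewrite /= ?ltcR// => w zw.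
have {}zw : Normc.normc (z - w) < e by rewrite -ltcR; exact: zw.
apply: le_lt_trans zw.
rewrite ler_norml normc_sub_le andbT lerNl opprB.
by rewrite -(@normcN _ (z - w)) opprB normc_sub_le.
Qed.

Lemma cvg_complex T (F : set_system T) {FF : Filter F} (f g : T -> R) (a b : R) :
  f @ F --> a -> g @ F --> b ->
  (fun t => (f t +i* g t)%C : (R[i])^o) @ F --> ((a +i* b)%C : (R[i])^o).
Proof.
move=> fa gb; apply/cvgrPdist_lt => e e0.
have eE : (complex.Re e)%:C%C = e by rewrite RRe_real// gtr0_real.
have e20 : 0 < complex.Re e / 2 by rewrite divr_gt0// -ltcR eE.
near=> t; rewrite norm_normc -eE ltcR.
rewrite (_ : (a +i* b)%C - _ = ((a - f t) +i* (b - g t))%C)//.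
apply: (le_lt_trans (normc_le_ReIm _ _)); rewrite [ltRHS]splitr ltrD//.
  by near: t; apply: cvgr_dist_lt.
by near: t; apply: cvgr_dist_lt.
Unshelve. all: by end_near. Qed.

Lemma real_complex_continuous : continuous ((real_complex R) : R -> (R[i])^o).
Proof. by move=> r; apply: cvg_complex; [exact: cvg_id|exact: cvg_cst]. Qed.

Lemma continuous_borelC_measurable (g : (R[i])^o -> R) : continuous g ->
  measurable_fun setT (g : borelC R -> R).
Proof.
move=> cg; apply: (measurability _ (RGenOInfty.measurableE R)) => //.
move=> _ [_ [r ->] <-]; rewrite setTI; apply: sub_sigma_algebra.
by apply: open_comp => // z _; exact: cg.
Qed.

Lemma measurable_real_complex : measurable_fun setT (real_complex R : R -> borelC R).
Proof.
have := @measurability _ _ _ (borelC R) setT (real_complex R : R -> borelC R) (@open (R[i])^o) erefl; apply.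
move=> _ [U oU <-]; rewrite setTI; apply: open_measurable.
by apply: open_comp => // z _; exact: real_complex_continuous.
Qed.

Context d (T : measurableType d).
Implicit Types (f : T -> R[i]).

Lemma measurable_Re f : cmeasurable f -> measurable_fun setT (fun x => complex.Re (f x)).
Proof.
exact: measurableT_comp (continuous_borelC_measurable Re_continuous).
Qed.

Lemma measurable_Im f : cmeasurable f -> measurable_fun setT (fun x => complex.Im (f x)).
Proof.
exact: measurableT_comp (continuous_borelC_measurable Im_continuous).
Qed.

Lemma measurable_normc f : cmeasurable f ->
  measurable_fun setT (fun x => Normc.normc (f x)).
Proof.
exact: measurableT_comp (continuous_borelC_measurable normc_continuous).
Qed.

Lemma cmeasurable_real (f : T -> R) : measurable_fun setT f ->
  cmeasurable (fun x => (f x)%:C%C).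
Proof. exact: measurableT_comp measurable_real_complex. Qed.

End complex_measurability.

Section Linf_facts.
Context d (T : measurableType d) (R : realType).
Variable mu : {measure set T -> \bar R}.
Implicit Types (f : T -> R[i]).

Lemma Linf_norm_le f (M : \bar R) : (0 <= M)%E ->
  (\forall x \ae mu, ((Normc.normc (f x))%:E <= M)%E) -> (Linf_norm mu f <= M)%E.
Proof.
move=> M0 fM; rewrite /Linf_norm unlock; case: ifP => // _.
apply/ess_supP; apply: filterS fM => x; rewrite /= ger0_norm//.
exact: normc_ge0.
Qed.

Lemma Linf_bounded f (K : R) : cmeasurable f ->
  (forall x, Normc.normc (f x) <= K) -> Linf mu f.
Proof.
move=> mf fK; split => //.
apply: (@le_lt_trans _ _ (`|K|)%:E); last exact: ltry.
apply: Linf_norm_le; first by rewrite lee_fin.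
by apply: aeW => x; rewrite lee_fin (le_trans (fK x))// ler_norm.
Qed.

Lemma Linf_ae_bounded f : Linf mu f ->
  exists K : R, 0 <= K /\ \forall x \ae mu, Normc.normc (f x) <= K.
Proof.
move=> [mf]; rewrite /Linf_norm unlock; case: ifPn => [mu0|].
  set e := ess_sup _ _ => e_fin.
  have ef := @ess_sup_ge _ _ _ mu (abse \o (fun x => (Normc.normc (f x))%:E)).
  rewrite -/e in ef; exists `|fine e|; split => //.
  apply: filterS ef => x /=; rewrite ger0_norm ?normc_ge0// => fx.
  have e_num : e \is a fin_num.
    rewrite ge0_fin_numE// (le_trans _ fx)// lee_fin normc_ge0//.
  by rewrite -lee_fin (le_trans fx)// -{1}(fineK e_num) lee_fin ler_norm.
rewrite -leNgt measure_le0 => /eqP mu0 _; exists 0; split => //.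
by exists setT; split.
Qed.

Lemma bounded_measurable_Linf (f : T -> R) : bounded_measurable f ->
  Linf mu (fun x => (f x)%:C%C).
Proof.
move=> [mf [K fK]]; apply: (@Linf_bounded _ K); first exact: cmeasurable_real.
by move=> x; rewrite normc_real.
Qed.

(** Dominated convergence: f_n g is dominated by K |g| for each integrable g. *)
Lemma wstar_cvg_dominated (f_ : nat -> T -> R) (f : T -> R) (K : R) :
  (forall n, measurable_fun setT (f_ n)) -> (forall n x, `|f_ n x| <= K) ->
  measurable_fun setT f -> (forall x, f_ ^~ x @ \oo --> f x) ->
  wstar_cvg_Linf mu ((fun n x => (f_ n x)%:C%C) @ \oo) (fun x => (f x)%:C%C).
Proof.
move=> mf_ fK mf ff g [mg g1].
(* h stands for the real part of g, then for its imaginary part *)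
have key (h : T -> R) : measurable_fun setT h ->
    (forall x, `|h x| <= Normc.normc (g x)) ->
    (fun n => fine (\int[mu]_x (f_ n x * h x)%:E)%E) @ \oo -->
    fine (\int[mu]_x (f x * h x)%:E)%E.
  move=> mh hg.
  have ih : mu.-integrable setT (EFin \o (fun x => K * Normc.normc (g x))).
    have ig : mu.-integrable setT (EFin \o (fun x => Normc.normc (g x))).
      apply/integrableP; split; first exact/measurable_EFinP/measurable_normc.
      rewrite (eq_integral (fun x => (Normc.normc (g x))%:E))// => x _ /=.
      by rewrite ger0_norm// normc_ge0.
    rewrite (_ : _ \o _ = (fun x => K%:E * (Normc.normc (g x))%:E)%E)//.
    exact: integrableZl.
  have [] := @dominated_convergence _ _ _ mu setT measurableT
    (fun n x => (f_ n x * h x)%:E) (fun x => (f x * h x)%:E)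
    (EFin \o (fun x => K * Normc.normc (g x))).
  - by move=> n; apply/measurable_EFinP; exact: measurable_funM.
  - by apply/measurable_EFinP; exact: measurable_funM.
  - apply/aeW => x _; apply/cvg_EFin; first exact: nearW.
    by apply: cvgM; [exact: ff|exact: cvg_cst].
  - exact: ih.
  - by apply/aeW => x n _ /=; rewrite lee_fin normrM ler_pM.
  move=> ifh _ c; apply: fine_cvg.
  by rewrite fineK//; exact: integrable_fin_num.
have E (u : T -> R) : cintegral mu (fun x => (u x)%:C%C * g x) =
   (fine (\int[mu]_x (u x * complex.Re (g x))%:E) +i*
     fine (\int[mu]_x (u x * complex.Im (g x))%:E))%C.
  by congr (fine _ +i* fine _)%C; apply: eq_integral => x _; congr (_%:E);
    case: (g x) => a b /=; rewrite mul0r ?subr0 ?addr0.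
have := cvg_complex (key _ (measurable_Re mg) (fun x => Re_le_normc _))
  (key _ (measurable_Im mg) (fun x => Im_le_normc _)).
rewrite -E (_ : (fun n => _) =
  (fun n => cintegral mu (fun x => (f_ n x)%:C%C * g x) : (R[i])^o)) ; last first.
  by apply/funext => n; rewrite E.
exact.
Qed.

End Linf_facts.

(** * Spectral measures *)

Section integral_of_set_functions.
Import HBSimple HBNNSimple.
Context d (T : measurableType d) (R : realType).

(** Integrals are suprema of sums of values of the set function on measurable
    sets. This allows the replacement of [diag_measure], which need not be
    nonnegative on other sets, by a measure. *)
Lemma eq_set_function_integral (mu nu : set T -> \bar R) (f : T -> \bar R) :
  (forall S, measurable S -> mu S = nu S) ->
  (\int[mu]_x f x = \int[nu]_x f x)%E.
Proof.
move=> munu.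
have E (g : T -> \bar R) :
    ereal_sup [set sintegral mu h | h in [set h : {nnsfun T >-> R} |
      forall x, ((h x)%:E <= g x)%E]] =
    ereal_sup [set sintegral nu h | h in [set h : {nnsfun T >-> R} |
      forall x, ((h x)%:E <= g x)%E]].
  congr ereal_sup; apply: eq_imagel => h _.
  rewrite /sintegral; apply: eq_fsbigr => r _; congr (_ * _)%E; apply: munu.
  exact: measurable_sfunP.
by rewrite /integral !E.
Qed.

End integral_of_set_functions.

Section spectral_measure_facts.
Context (R : realType) (H : completeNormedModType R[i]).
Context (dot : {dot H for Num.conj}) (Hdot : hilbert_product dot).
Implicit Types (x y : H).

Lemma projection_dot (P : H -> H) x y : orthogonal_projection dot P ->
  dot (P x) y = dot (P x) (P y).
Proof. by move=> [_ PP Pd]; rewrite -Pd PP. Qed.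

Lemma projection_sqnorm (P : H -> H) x : orthogonal_projection dot P ->
  dot (P x) x = (sqnorm (P x))%:C%C.
Proof. by move=> oP; rewrite (projection_dot x x oP) Hdot sqnormE. Qed.

Lemma projection_norm_le (P : H -> H) x : orthogonal_projection dot P ->
  `|P x| <= `|x|.
Proof.
move=> oP; have [->|Px0] := eqVneq (P x) 0; first by rewrite normr0.
rewrite -(@ler_pM2l _ `|P x|) ?normr_gt0// -expr2 -sqnormE -projection_sqnorm//.
apply: le_trans (dot_norm_le Hdot _ _).
by rewrite projection_sqnorm// normc_def/= expr0n addr0 sqrtr_sqr lecR ler_norm.
Qed.

Lemma projection_bounded (P : H -> H) : orthogonal_projection dot P ->
  bounded_op P.
Proof.
move=> oP; split; first by case: oP.
by exists 1 => x; rewrite mul1r projection_norm_le.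
Qed.

Lemma polarization x y :
  4^-1 * (\sum_(k < 4) 'i ^+ k * `|x + 'i ^+ k *: y| ^+ 2) = dot x y.
Proof.
have iE : 'i ^+ 2 = -1 :> R[i] by exact: sqrCi.
have ic : ('i : R[i])^* = - 'i by exact: conjCi.
have E k : `|x + 'i ^+ k *: y| ^+ 2 = `|x| ^+ 2 + `|'i ^+ k : R[i]| ^+ 2 * `|y| ^+ 2
   + ('i ^+ k)^* * dot x y + 'i ^+ k * dot y x.
  rewrite -Hdot dotDl !dotDr !dotZl !dotZr !Hdot normCK; ring.
under eq_bigr do rewrite E normrX normCi !expr1n mul1r.
rewrite !big_ord_recl big_ord0 /= /bump /= !add1n.
rewrite !rmorphXn/= ic !(exprS _ 2) !(exprS _ 1) !expr1 !expr0.
have ii : 'i * 'i = -1 :> R[i] by rewrite -expr2.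
have four : 4 != 0 :> R[i] by rewrite pnatr_eq0.
rewrite -[RHS](mulKf four); congr (_ * _); ring: ii.
Qed.

End spectral_measure_facts.

(** The measure E_{x,x}, with <E(S) x, x> written as |E(S) x|^2 so that it is
    nonnegative on every set. The proofs are arguments because the measure
    structure depends on them. *)
Definition diagonal_measure (R : realType) (H : completeNormedModType R[i])
    (dot : {dot H for Num.conj}) (Hdot : hilbert_product dot)
    (E : set (borelC R) -> H -> H) (hE : projection_valued_measure dot E)
    (x : H) (S : set (borelC R)) : \bar R := (sqnorm (E S x))%:E.

Section pvm.
Context (R : realType) (H : completeNormedModType R[i]).
Context (dot : {dot H for Num.conj}) (Hdot : hilbert_product dot).
Context (E : set (borelC R) -> H -> H) (hE : projection_valued_measure dot E).
Implicit Types (x y : H).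
Local Notation nu := (diagonal_measure Hdot hE).

Lemma pvm_projection S : measurable S -> orthogonal_projection dot (E S).
Proof. by have [h _ _ _] := hE; exact: h. Qed.

(** The empty set is a disjoint union of copies of itself, so the multiples
    n v of v = E(set0) x converge, which forces v = 0. *)
Lemma pvm_set0 x : E set0 x = 0.
Proof.
have [_ _ _ hU] := hE.
have h := hU (fun=> set0) (fun=> measurable0).
have tF : trivIset [set: nat] (fun=> set0 : set (borelC R)).
  by move=> i j _ _ [z []].
move: (h tF x); rewrite bigcup0//.
set v := E set0 x => vc.
have vS : [sequence \sum_(0 <= k < n.+1) v]_n @ \oo --> v.
  by rewrite (cvg_shiftS (fun n => \sum_(0 <= k < n) v)).
have dv : ([sequence \sum_(0 <= k < n.+1) v]_n - (fun n => \sum_(0 <= k < n) v))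
    = (fun=> v) :> (nat -> H).
  by apply/funext => n; rewrite !fctE/= big_nat_recr//= addrAC subrr add0r.
have := cvgB vS vc; rewrite subrr dv => c0.
by rewrite -(cvg_lim (@norm_hausdorff _ H) (c0 _)) lim_cst//; exact: norm_hausdorff.
Qed.

Lemma diag_measureE x S : measurable S -> diag_measure dot E x S = nu x S.
Proof.
by move=> mS; rewrite /diag_measure projection_sqnorm//; exact: pvm_projection.
Qed.

Let nu0 x : nu x set0 = 0%E.
Proof. by rewrite /diagonal_measure pvm_set0 sqnorm0. Qed.

Let nu_ge0 x S : (0 <= nu x S)%E.
Proof. by rewrite lee_fin sqnorm_ge0. Qed.

Let nu_additive x : semi_sigma_additive (nu x).
Proof.
move=> F mF tF mUF.
have [_ _ _ hU] := hE; have Fx := hU F mF tF x.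
have := cvg_comp _ (dot^~ x) Fx (dotl_continuous Hdot x _).
move=> /(cvg_comp _ (@complex.Re R)) /(_ (@Re_continuous R _)) h.
rewrite -diag_measureE// /diag_measure.
apply/cvg_EFin.
  by apply: nearW => n; rewrite sumEFin.
move: h; apply: cvg_trans; apply: near_eq_cvg; apply: nearW => n /=.
rewrite dot_suml raddf_sum sumEFin/=; apply: eq_bigr => k _.
by rewrite projection_sqnorm//; exact: pvm_projection.
Qed.

HB.instance Definition _ x := isMeasure.Build _ _ _ (nu x)
  (nu0 x) (nu_ge0 x) (@nu_additive x).

Let nu_fin x : fin_num_fun (nu x).
Proof. by []. Qed.

HB.instance Definition _ x := Measure_isFinite.Build _ _ _ (nu x) (@nu_fin x).

(** By polarization <E(S) x, y> is the polar integral of the indicator of S. *)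
Lemma spectral_integral_indic (S : set (borelC R)) : measurable S ->
  spectral_integral dot E (fun z : borelC R => (\1_S z)%:C%C) = E S.
Proof.
move=> mS; have oS := pvm_projection mS.
have cE u : cintegral (diag_measure dot E u) (fun z : borelC R => (\1_S z)%:C%C) =
    (sqnorm (E S u))%:C%C.
  rewrite /cintegral; congr (_ +i* _)%C.
    rewrite (eq_set_function_integral _ (@diag_measureE u)) integral_indic//.
    by rewrite setIT.
  by rewrite (eq_set_function_integral _ (@diag_measureE u)) integral0.
have polE x y : polar_integral dot E (fun z : borelC R => (\1_S z)%:C%C) x y =
    dot (E S x) y.
  rewrite projection_dot// -polarization// /polar_integral; congr (_ * _).
  apply: eq_bigr => k _; congr (_ * _); rewrite cE sqnormE.
  by have [linE _ _] := oS; rewrite addrC linE addrC.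
have : [set T | bounded_op T /\ forall x y, dot (T x) y =
    polar_integral dot E (fun z : borelC R => (\1_S z)%:C%C) x y]
    (spectral_integral dot E (fun z : borelC R => (\1_S z)%:C%C)).
  apply: getPex; exists (E S); split; first exact: projection_bounded.
  by move=> x y; rewrite polE.
move=> [_ h]; apply/funext => x; apply: (dot_injl Hdot) => y.
by rewrite h polE.
Qed.

(** Projections are contractions, so E(S) vanishes if it vanishes on a dense
    set. *)
Lemma diagonal_measure_dense (D : set H) (S : set (borelC R)) : dense D ->
  measurable S -> (forall x, D x -> nu x S = 0%E) -> forall x, E S x = 0.
Proof.
move=> dD mS D0 x; have oS := pvm_projection mS.
have [linE _ _] := oS.
apply/eqP; rewrite -normr_eq0; apply/negPn/negP => Ex0.
have Egt0 : 0 < `|E S x| by rewrite lt_def Ex0 normr_ge0.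
have [z [/= xz Dz]] : ball x `|E S x| `&` D !=set0.
  apply: dD; [by exists x; exact: ballxx|exact: ball_open].
have Ez : E S z = 0.
  by apply: sqnorm_eq0; have := D0 z Dz; rewrite /diagonal_measure => -[].
have := projection_norm_le Hdot (x - z) oS.
have -> : E S (x - z) = E S x.
  by rewrite addrC -scaleN1r linE Ez scaler0 add0r.
move: xz; rewrite -ball_normE/= => /lt_le_trans h /h.
by rewrite ltxx.
Qed.

End pvm.

(** * Rational directions in the unit disc *)

Section rational_directions.
Context (R : realType).

Lemma rat_approx (x e : R) : 0 < e -> exists q : rat, `|ratr q - x| <= e.
Proof.
move=> e0; have [q] := rat_in_itvoo (ltr_pwDr e0 (lexx x)).
rewrite in_itv/= => /andP[xq qx]; exists q.
by rewrite ger0_norm ?subr_ge0 ?(ltW xq)// lerBlDl (ltW qx).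
Qed.

(** The modulus of z is the supremum of Re (w z) over |w| <= 1, and countably
    many w, with rational coordinates, are enough. *)
Lemma rational_direction (z : R[i]) (c : R) : 0 <= c -> c < Normc.normc z ->
  exists (p q : rat) (n : nat), Normc.normc (ratr p +i* ratr q)%C <= 1 :> R /\
    c + n.+1%:R^-1 < ratr p * complex.Re z - ratr q * complex.Im z.
Proof.
move=> c0; set r := Normc.normc z => cr.
have r0 : 0 < r by exact: le_lt_trans cr.
set x := complex.Re z; set y := complex.Im z.
have xr : `|x| <= r by exact: Re_le_normc.
have yr : `|y| <= r by exact: Im_le_normc.
have rE : x ^+ 2 + y ^+ 2 = r ^+ 2.
  apply: complexI; rewrite /x /y add_Re2_Im2 norm_normc -rmorphXn//.
(* s is such that s r is the midpoint of c and r; p and q are taken within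
   e of the coordinates of t conj(z) / r, where t + 2 e = 1 keeps p + i q in the
   disc and t - 2 e = s makes Re ((p + i q) z) at least s r. *)
pose s := (c + r) / (2 * r).
have s1 : s < 1 by rewrite /s ltr_pdivrMr ?mulr_gt0// mul1r; lra.
have s0 : 0 < s by rewrite divr_gt0 ?mulr_gt0// ltr_wpDl.
have csr : c < s * r.
  have -> : s * r = (c + r) / 2 by rewrite /s; field; rewrite gt_eqF.
  by lra.
pose t := (1 + s) / 2; pose e := (1 - t) / 2.
have e0 : 0 < e by rewrite /e /t; lra.
have [p pE] := rat_approx (t * x / r) e0.
have [q qE] := rat_approx (- (t * y / r)) e0.
have [n cn] := ltr_add_invr csr.
exists p, q, n; split; last first.
  apply: (lt_le_trans cn).
  set u := ratr p - _ in pE; set v := ratr q - _ in qE.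
  have -> : ratr p * x - ratr q * y = t * r + u * x - v * y.
    have -> : t * r = t * (x ^+ 2 + y ^+ 2) / r.
      by rewrite rE; field; rewrite gt_eqF.
    by rewrite /u /v; field; rewrite gt_eqF.
  have ux : - (e * r) <= u * x.
    by rewrite -[u * x]opprK lerN2 -mulNr (le_trans (ler_norm _))// normrM normrN ler_pM.
  have vy : v * y <= e * r.
    by rewrite (le_trans (ler_norm _))// normrM ler_pM.
  have -> : s * r = t * r - e * r - e * r by rewrite /e /t; field.
  by lra.
have -> : (ratr p +i* ratr q)%C = (t / r)%:C%C * conjc z +
    ((ratr p - t * x / r) +i* (ratr q + t * y / r))%C.
  rewrite /x /y; case: (z) => a b /=; congr (_ +i* _)%C => /=; ring.
apply: (le_trans (le_normcD _ _)).
rewrite Normc.normcM normc_real.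
have -> : Normc.normc (conjc z) = r.
  by apply: complexI; rewrite -!norm_normc normcJ.
rewrite ger0_norm; last by rewrite divr_ge0 ?ltW// /t; lra.
rewrite divfK ?gt_eqF//.
have := le_trans (normc_le_ReIm _ _) (lerD pE _).
move=> /(_ (ratr q + t * y / r) e); rewrite opprK in qE => /(_ qE) h.
by rewrite (le_trans (lerD (lexx t) h))// /e; lra.
Qed.

End rational_directions.

(** * The lower bound for the triple operator integral *)

Section lower_bound.
Context (R : realType) (H : completeNormedModType R[i]).
Context (dot : {dot H for Num.conj}) (Hdot : hilbert_product dot).
Context (EA EB EC : set (borelC R) -> H -> H).
Context (pA : projection_valued_measure dot EA)
  (pB : projection_valued_measure dot EB)
  (pC : projection_valued_measure dot EC).
Context (lA lB lC : {finite_measure set (borelC R) -> \bar R}).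
Context (Gam : (borelC R * borelC R * borelC R -> R[i]) ->
  (H -> H) -> (H -> H) -> (H -> H)).
Context (hGam : is_triple_operator_integral dot lA lB lC EA EB EC Gam).
Local Notation T := (borelC R * borelC R * borelC R)%type.
Local Notation mu := (triple_product lA lB lC).
Local Notation emb f := (fun s : T => (f s)%:C%C).
Implicit Types (f : T -> R) (a b c : H).

(** The pairing of Gam phi with the elementary tensor of the three rank one
    operators built cyclically on a, b, c. The cycle is chosen so that a tensor
    f1 (x) f2 (x) f3 is sent to <f1(A) a, a> <f2(B) b, b> <f3(C) c, c>. *)
Definition rank1_value a b c (phi : T -> R[i]) : R[i] :=
  dot (Gam phi (rank1 dot a b) (rank1 dot b c) c) a.

Lemma rank1_value_lin a b c (k : R[i]) phi psi : Linf mu phi -> Linf mu psi ->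
  rank1_value a b c (fun s => k * phi s + psi s) =
  k * rank1_value a b c phi + rank1_value a b c psi.
Proof.
move=> Lphi Lpsi; rewrite /rank1_value (toi_linear hGam)//; try exact: rank1_hs.
by rewrite dotDl dotZl.
Qed.

(** w*-continuity of Gam along the sequence f_n, tested on one elementary
    tensor. *)
Lemma rank1_value_cvg a b c (f_ : nat -> T -> R) f (K : R) :
  (forall n, measurable_fun setT (f_ n)) ->
  (forall n x, `|f_ n x| <= K) -> measurable_fun setT f ->
  (forall x, f_ ^~ x @ \oo --> f x) ->
  (fun n => rank1_value a b c (emb (f_ n)) : (R[i])^o) @ \oo -->
  (rank1_value a b c (emb f) : (R[i])^o).
Proof.
move=> mf_ fK mf ff.
have bf_ n : Linf mu (emb (f_ n)).
  by apply: bounded_measurable_Linf; split; [exact: mf_|exists K].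
have bf := bounded_measurable_lim fK mf ff.
have Lf := bounded_measurable_Linf mu bf.
have FL : ((fun n => emb (f_ n)) @ \oo) (Linf mu).
  by exists 0%N => // n _; exact: bf_.
have wG := toi_wstar_continuous hGam _ FL Lf
  (wstar_cvg_dominated (mu := mu) mf_ fK mf ff).
have := wG _ _ _ _ (rank1_proj_tensor Hdot a b b c c a).
rewrite bilinear_pairing_rank1//; last exact: (toi_codomain hGam Lf).
rewrite (_ : (fun n => _) = fun n => bilinear_pairing dot (Gam (emb (f_ n)))
    (fun=> rank1 dot a b) (fun=> rank1 dot b c)
    (fun n => rank1 dot (if n == 0%N then c else 0) a)); last first.
  apply/funext => n; rewrite bilinear_pairing_rank1//.
  exact: (toi_codomain hGam (bf_ n)).
exact.
Qed.

Lemma rank1_value_box a b c A1 A2 A3 : measurable A1 -> measurable A2 ->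
  measurable A3 ->
  rank1_value a b c (emb (\1_(box A1 A2 A3))) =
  (sqnorm (EA A1 a) * sqnorm (EB A2 b) * sqnorm (EC A3 c))%:C%C.
Proof.
move=> m1 m2 m3.
have lI (l : {finite_measure set (borelC R) -> \bar R}) (A : set (borelC R)) :
    measurable A -> Linf l (fun z : borelC R => (\1_A z)%:C%C).
  by move=> mA; apply: bounded_measurable_Linf; exact: bounded_measurable_indic.
have -> : emb (\1_(box A1 A2 A3)) = tensor3 (fun z : borelC R => (\1_A1 z)%:C%C)
    (fun z : borelC R => (\1_A2 z)%:C%C) (fun z : borelC R => (\1_A3 z)%:C%C).
  apply/funext => -[[x y] z]; rewrite /tensor3 -!rmorphM/= !indicE.
  rewrite /box !in_setX/=.
  by case: (x \in A1); case: (y \in A2); case: (z \in A3);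
    rewrite ?(mulr1, mulr0, mul0r).
rewrite /rank1_value (toi_tensor hGam); try exact: lI; try exact: rank1_hs.
rewrite !spectral_integral_indic//= /rank1.
have [linA _ _] := pvm_projection pA m1.
have [linB _ _] := pvm_projection pB m2.
rewrite (linear_scale _ _ linB) (linear_scale _ _ linA) !dotZl !(projection_sqnorm Hdot)//; try exact: pvm_projection.
by rewrite -!rmorphM/=; congr (_%:C)%C; ring.
Qed.

Local Notation nu a b c :=
  (triple_product (diagonal_measure Hdot pA a) (diagonal_measure Hdot pB b)
     (diagonal_measure Hdot pC c)).

Lemma nu_box a b c A1 A2 A3 : measurable A1 -> measurable A2 ->
  measurable A3 -> nu a b c (box A1 A2 A3) =
  (sqnorm (EA A1 a) * sqnorm (EB A2 b) * sqnorm (EC A3 c))%:E.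
Proof.
move=> m1 m2 m3; rewrite -[LHS]/(((diagonal_measure Hdot pA a \x
  diagonal_measure Hdot pB b) \x diagonal_measure Hdot pC c)%E ((A1 `*` A2) `*` A3)).
rewrite product_measure1E//; last exact: measurableX.
rewrite EFinM; congr (_ * _)%E.
exact: (product_measure1E (diagonal_measure Hdot pA a) (diagonal_measure Hdot pB b) m1 m2).
Qed.

Lemma nu_finite a b c : (nu a b c setT < +oo)%E.
Proof. by rewrite -setXTT -setXTT -/(box _ _ _) nu_box// ltry. Qed.

Lemma rank1_value_emb_lin a b c (k : R) f g : bounded_measurable f ->
  bounded_measurable g ->
  rank1_value a b c (emb (fun x => k * f x + g x)) =
  k%:C%C * rank1_value a b c (emb f) + rank1_value a b c (emb g).
Proof.
move=> bf bg; rewrite -rank1_value_lin; try exact: bounded_measurable_Linf.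
by congr rank1_value; apply/funext => x; rewrite rmorphD rmorphM.
Qed.

Lemma rank1_value_Re_dominated a b c :
  dominated_functional (fun f : T -> R => complex.Re (rank1_value a b c (emb f))).
Proof.
split=> [k f g bf bg|f_ f K mf_ fK mf ff].
  rewrite rank1_value_emb_lin//.
  by case: (rank1_value _ _ _ _) => x y; case: (rank1_value _ _ _ _) => z w /=; ring.
exact: (cvg_comp _ _ (rank1_value_cvg (a := a) (b := b) (c := c) mf_ fK mf ff)
  (@Re_continuous R _)).
Qed.

Lemma rank1_value_Im_dominated a b c :
  dominated_functional (fun f : T -> R => complex.Im (rank1_value a b c (emb f))).
Proof.
split=> [k f g bf bg|f_ f K mf_ fK mf ff].
  rewrite rank1_value_emb_lin//.
  by case: (rank1_value _ _ _ _) => x y; case: (rank1_value _ _ _ _) => z w /=; ring.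
exact: (cvg_comp _ _ (rank1_value_cvg (a := a) (b := b) (c := c) mf_ fK mf ff)
  (@Im_continuous R _)).
Qed.

(** Both sides are dominated functionals of f, and they agree on boxes since
    E(S') E(S) = E(S' n S). Thus [rank1_value] is an integral, and localizing it
    to a box amounts to projecting the vectors. *)
Lemma rank1_value_restrict a b c S1 S2 S3 f : measurable S1 -> measurable S2 ->
  measurable S3 -> bounded_measurable f ->
  rank1_value (EA S1 a) (EB S2 b) (EC S3 c) (emb f) =
  (Rintegral (nu a b c) setT (fun s => \1_(box S1 S2 S3) s * f s))%:C%C.
Proof.
move=> m1 m2 m3 bf.
have boxE A1 A2 A3 : measurable A1 -> measurable A2 -> measurable A3 ->
    rank1_value (EA S1 a) (EB S2 b) (EC S3 c) (emb (\1_(box A1 A2 A3))) =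
    (Rintegral (nu a b c) setT
      (fun s => \1_(box S1 S2 S3) s * \1_(box A1 A2 A3) s))%:C%C.
  move=> n1 n2 n3; rewrite rank1_value_box//.
  have [[_ _ iA _] [_ _ iB _] [_ _ iC _]] := And3 pA pB pC.
  rewrite -iA// -iB// -iC//; congr (_%:C)%C.
  rewrite (_ : (fun s => _) = \1_(box (A1 `&` S1) (A2 `&` S2) (A3 `&` S3)) :> (T -> R)).
    rewrite /Rintegral integral_indic//; last first.
      by apply: measurable_box; exact: measurableI.
    by rewrite setIT nu_box//; exact: measurableI.
  by rewrite -box_setI indicI; apply/funext => s; rewrite mulrC.
have J := Rintegral_dominated (nu_finite a b c).
have JR := dominated_functional_restrict J
  (bounded_measurable_indic R (measurable_box m1 m2 m3)).
have realE (z : R[i]) (r : R) : complex.Re z = r -> complex.Im z = 0 ->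
    z = r%:C%C by case: z => u v /= -> ->.
apply: realE.
- apply: (dominated_functional_boxes (rank1_value_Re_dominated _ _ _) JR) => //.
  by move=> A1 A2 A3 n1 n2 n3; rewrite boxE.
- apply: (dominated_functional_boxes (rank1_value_Im_dominated _ _ _)
    (dominated_functional_cst0 _ _)) => //.
  by move=> A1 A2 A3 n1 n2 n3; rewrite boxE.
Qed.

Lemma rank1_value_le a b c phi (M : R) : Linf mu phi -> 0 <= M ->
  bilinear_norm dot (Gam phi) = M%:E ->
  Normc.normc (rank1_value a b c phi) <= M * (sqnorm a * sqnorm b * sqnorm c).
Proof.
move=> Lphi M0 GM.
have := bilinear_norm_rank1 Hdot a b b c c a (toi_codomain hGam Lphi) GM.
rewrite -/(rank1_value a b c phi); set z := rank1_value _ _ _ _.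
have -> : sqmod z = Normc.normc z ^+ 2.
  by apply: complexI; rewrite sqmodE norm_normc rmorphXn.
rewrite (_ : M ^+ 2 * _ = (M * (sqnorm a * sqnorm b * sqnorm c)) ^+ 2); last by ring.
by rewrite ler_pXn2r// nnegrE ?normc_ge0// !mulr_ge0// sqnorm_ge0.
Qed.

(** On a box R with sides S1, S2, S3, the integral of phi is the value of Gam phi
    at the vectors E(S1) a, E(S2) b, E(S3) c, hence is at most M nu(R) in
    modulus. For |w| <= 1 the integral of M - Re (w phi) is therefore nonnegative
    on boxes, then on all measurable sets, so that Re (w phi) <= M almost
    everywhere. *)
Lemma ae_le_bilinear_norm a b c phi (K M : R) : cmeasurable phi ->
  (forall s, Normc.normc (phi s) <= K) -> 0 <= M ->
  bilinear_norm dot (Gam phi) = M%:E ->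
  \forall s \ae nu a b c, Normc.normc (phi s) <= M.
Proof.
move=> mphi phiK M0 GM.
have Lphi := Linf_bounded mu mphi phiK.
pose re := fun s => complex.Re (phi s); pose im := fun s => complex.Im (phi s).
have bre : bounded_measurable (re : T -> R).
  split; first exact: measurable_Re.
  by exists K => s; rewrite (le_trans (Re_le_normc _)).
have bim : bounded_measurable (im : T -> R).
  split; first exact: measurable_Im.
  by exists K => s; rewrite (le_trans (Im_le_normc _)).
have J := Rintegral_dominated (nu_finite a b c).
have phiE x y z : rank1_value x y z phi =
    'i%C * rank1_value x y z (emb im) + rank1_value x y z (emb re).
  rewrite -rank1_value_lin; try exact: bounded_measurable_Linf.
  by congr rank1_value; apply/funext => s; rewrite addrC -complexE.
have null (p q : rat) (n : nat) : Normc.normc (ratr p +i* ratr q)%C <= 1 :> R ->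
    \forall s \ae nu a b c,
      ~ (M + n.+1%:R^-1 < ratr p * re s - ratr q * im s).
  move=> pq1.
  pose theta s := -1 * (ratr p * re s + (- ratr q) * im s) + M.
  have bpq : bounded_measurable (fun s => ratr p * re s + (- ratr q) * im s).
    apply: bounded_measurable_lin => //; apply: bounded_measurable_mul => //.
    exact: bounded_measurable_cst.
  have bth : bounded_measurable theta.
    by apply: bounded_measurable_lin => //; exact: bounded_measurable_cst.
  have Jth := dominated_functional_restrict J bth.
  have Jbox A1 A2 A3 : measurable A1 -> measurable A2 -> measurable A3 ->
      0 <= Rintegral (nu a b c) setT (fun s => theta s * \1_(box A1 A2 A3) s).
    move=> m1 m2 m3; have mb := measurable_box m1 m2 m3.
    have b1 := bounded_measurable_indic R mb.
    have JR := dominated_functional_restrict J b1.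
    rewrite (_ : (fun s => _) = fun s => \1_(box A1 A2 A3) s * theta s); last first.
      by apply/funext => s; rewrite mulrC.
    rewrite JR.1//; last exact: bounded_measurable_cst.
    rewrite JR.1//; last first.
      by apply: bounded_measurable_mul => //; exact: bounded_measurable_cst.
    rewrite (dominated_functionalZ _ JR)//.
    rewrite (_ : (fun s => \1_(box A1 A2 A3) s * M) =
      fun s => M * \1_(box A1 A2 A3) s); last by apply/funext => s; rewrite mulrC.
    rewrite (dominated_functionalZ _ J)//.
    have -> : Rintegral (nu a b c) setT (\1_(box A1 A2 A3)) =
        sqnorm (EA A1 a) * sqnorm (EB A2 b) * sqnorm (EC A3 c).
      by rewrite /Rintegral integral_indic// setIT nu_box.
    have := rank1_value_le (EA A1 a) (EB A2 b) (EC A3 c) Lphi M0 GM.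
    rewrite phiE !rank1_value_restrict//.
    (* the value z = JE + i JI of Gam phi at the projected vectors satisfies
       p JE - q JI = Re ((p + i q) z) <= |z| *)
    set JI := Rintegral _ _ _; set JE := Rintegral _ _ _; set v := (_ * _ * _).
    have -> : 'i%C * JI%:C%C + JE%:C%C = (JE +i* JI)%C :> R[i].
      by congr (_ +i* _)%C; ring.
    move=> zM; have := Re_le_normc ((ratr p +i* ratr q)%C * (JE +i* JI)%C).
    rewrite Normc.normcM.
    have := ler_wpM2r (normc_ge0 (JE +i* JI)%C) pq1; rewrite mul1r => h1 h2.
    have h3 := le_trans (le_trans (ler_norm _) h2) (le_trans h1 zM).
    by move: h3 => /=; lra.
  have Jpos := ge0_on_boxes Jth Jbox.
  pose N := [set s | M + n.+1%:R^-1 < ratr p * re s - ratr q * im s].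
  have mN : measurable N.
    have [mpq _] := bpq.
    rewrite (_ : N = setT `&` (fun s => ratr p * re s + (- ratr q) * im s) @^-1`
      `]M + n.+1%:R^-1, +oo[); first exact: mpq.
    by rewrite setTI; apply/seteqP; split => s; rewrite /N /= in_itv/= andbT mulNr.
  have d0 : 0 < n.+1%:R^-1 :> R by rewrite invr_gt0 ltr0n.
  have bN := bounded_measurable_indic R mN.
  have nuN : nu a b c N = 0%E.
    have nuN_fin : nu a b c N \is a fin_num.
      rewrite ge0_fin_numE// (le_lt_trans _ (nu_finite a b c))//.
      by apply: le_measure; rewrite ?inE.
    have J1 : Rintegral (nu a b c) setT (\1_N) = fine (nu a b c N).
      by rewrite /Rintegral integral_indic// setIT.
    (* on N one has - theta > 1 / (n + 1) *)
    have : 0 <= Rintegral (nu a b c) setT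
        (fun s => (- n.+1%:R^-1) * \1_N s + -1 * (theta s * \1_N s)).
      apply: Rintegral_ge0 => s _; rewrite indicE.
      have [|] := boolP (s \in N); last by rewrite !mulr0 addr0.
      rewrite inE /N /theta /= !mulr1 => h.
      rewrite [leRHS](_ : _ = (ratr p * re s - ratr q * im s) - (M + n.+1%:R^-1));
        last by ring.
      by rewrite subr_ge0 ltW.
    rewrite (J.1 (- n.+1%:R^-1) (\1_N) (fun s => -1 * (theta s * \1_N s)))//;
      last by do 2?[apply: bounded_measurable_mul => //];
      exact: bounded_measurable_cst.
    rewrite (dominated_functionalZ _ J); last exact: bounded_measurable_mul.
    rewrite J1 => h; have h' := Jpos N mN.
    have : n.+1%:R^-1 * fine (nu a b c N) <= 0.
      rewrite -oppr_ge0 -mulNr (le_trans h)// gerDl mulN1r oppr_le0.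
      exact: h'.
    rewrite pmulr_rle0// => f0; apply/eqP.
    by rewrite eq_le measure_ge0 andbT -(fineK nuN_fin) lee_fin.
  exists N; split => // s /=; rewrite -/(N s).
  by move/contrapT.
have : \forall s \ae nu a b c, forall pqn : rat * rat * nat,
    Normc.normc (ratr pqn.1.1 +i* ratr pqn.1.2)%C <= 1 :> R ->
    ~ (M + pqn.2.+1%:R^-1 < ratr pqn.1.1 * re s - ratr pqn.1.2 * im s).
  apply: ae_forall_count => -[[p q] n] /=.
  have [pq1|npq] := pselect (Normc.normc (ratr p +i* ratr q)%C <= 1 :> R).
    by apply: filterS (null p q n pq1).
  exact: aeW.
apply: filterS => s sN; rewrite leNgt; apply/negP => /(rational_direction M0).
by move=> [p [q [n [pq1 h]]]]; exact: (sN (p, q, n)).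
Qed.

End lower_bound.

Section isometry_lemmas.
Context (R : realType) (H : completeNormedModType R[i]).
Context (dot : {dot H for Num.conj}) (Hdot : hilbert_product dot).

Lemma bilinear_norm_ge0 (G : (H -> H) -> (H -> H) -> (H -> H)) :
  (0 <= bilinear_norm dot G)%E.
Proof.
apply: (@le_trans _ _ (hs_norm dot (G (rank1 dot 0 0) (rank1 dot 0 0)))).
  exact: hs_norm_ge0.
apply: ereal_sup_ubound; exists (rank1 dot 0 0, rank1 dot 0 0) => //=.
by split; rewrite ?hs_norm_rank1 ?sqnorm0 ?mul0r ?sqrtr0//; exact: rank1_hs.
Qed.

(** If E(S) kills a dense sequence of vectors then E(S) = 0. *)
Lemma scalar_measure_dominated (A : partial_op H) (E : set (borelC R) -> H -> H)
    (pE : projection_valued_measure dot E)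
    (l : {finite_measure set (borelC R) -> \bar R}) (e : nat -> H) :
  dense (range e) -> scalar_spectral_measure A E l ->
  dominated_by_family (fun n => diagonal_measure Hdot pE (e n)) l.
Proof.
move=> de [_ lE] S mS e0; apply/(lE S mS) => x.
by apply: (@diagonal_measure_dense _ _ _ Hdot _ pE _ S de mS) => _ [n _ <-]; exact: e0.
Qed.

Lemma separable_sequence : separable H -> exists e : nat -> H, dense (range e).
Proof.
move=> [D cD dD]; have /pcard_surjP[e De] := cD.
exists e => U U0 oU; have [x [Ux Dx]] := dD U U0 oU.
by exists x; split => //; exact: De.
Qed.

Lemma truncation_measurable d (T : measurableType d) (phi : T -> R[i]) (K : R) :
  cmeasurable phi ->
  cmeasurable (fun s => if Normc.normc (phi s) <= K then phi s else 0).
Proof.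
move=> mphi; apply: measurable_fun_ifT => //.
by apply: measurable_fun_ler; [exact: measurable_normc|exact: measurable_cst].
Qed.

End isometry_lemmas.

Theorem corollary10 (R : realType) (H : completeNormedModType R[i])
    (dot : {dot H for Num.conj}) (Hdot : hilbert_product dot)
    (Hsep : separable H)
    (A B C : partial_op H)
    (nA : normal_op dot A) (nB : normal_op dot B) (nC : normal_op dot C)
    (EA EB EC : set (borelC R) -> H -> H)
    (hEA : is_spectral_measure dot A EA)
    (hEB : is_spectral_measure dot B EB)
    (hEC : is_spectral_measure dot C EC)
    (lA lB lC : {finite_measure set (borelC R) -> \bar R})
    (hlA : scalar_spectral_measure A EA lA)
    (hlB : scalar_spectral_measure B EB lB)
    (hlC : scalar_spectral_measure C EC lC)
    (Gam : (borelC R * borelC R * borelC R -> R[i]) ->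
           (H -> H) -> (H -> H) -> (H -> H))
    (hGam : is_triple_operator_integral dot lA lB lC EA EB EC Gam) :
  forall phi, Linf (triple_product lA lB lC) phi ->
    bilinear_norm dot (Gam phi) = Linf_norm (triple_product lA lB lC) phi.
Proof.
move=> phi Lphi; have [mphi _] := Lphi.
set mu := triple_product lA lB lC.
apply/eqP; rewrite eq_le; apply/andP; split; first exact: (toi_contraction hGam).
have [_ _ _ Gfin] := toi_codomain hGam Lphi.
have G0 := bilinear_norm_ge0 Hdot (Gam phi).
pose M := fine (bilinear_norm dot (Gam phi)).
have GM : bilinear_norm dot (Gam phi) = M%:E by rewrite fineK// ge0_fin_numE.
have M0 : 0 <= M by rewrite -lee_fin -GM.
have [K [K0 phiK]] := Linf_ae_bounded Lphi.
(* phi is only essentially bounded, and the bound may fail on a set which is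
   null for mu; psi represents the same class and is bounded. *)
pose psi s := if Normc.normc (phi s) <= K then phi s else 0.
have mpsi : cmeasurable psi by exact: truncation_measurable.
have psiK s : Normc.normc (psi s) <= K.
  by rewrite /psi; case: ifP => // _; rewrite Normc.normc0.
have Lpsi := Linf_bounded mu mpsi psiK.
have phipsi : ae_eq mu setT phi psi.
  by apply: filterS phiK => s phis _; rewrite /psi phis.
have GpsiM : bilinear_norm dot (Gam psi) = M%:E.
  rewrite -GM; congr ereal_sup; apply: eq_imagel => -[X Y] [/= SX SY _ _].
  by rewrite (toi_ae hGam Lphi Lpsi phipsi).
have pA := spectral_pvm hEA; have pB := spectral_pvm hEB.
have pC := spectral_pvm hEC.
have [e de] := separable_sequence Hsep.
pose N : set (borelC R * borelC R * borelC R) := [set s | M < Normc.normc (psi s)].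
have mN : measurable N.
  rewrite (_ : N = setT `&` (fun s => Normc.normc (psi s)) @^-1` `]M, +oo[).
    exact: (measurable_normc mpsi).
  by rewrite setTI; apply/seteqP; split => s; rewrite /N /= in_itv/= andbT.
pose nuAB (ij : nat * nat) :=
  finite_product (diagonal_measure Hdot pA (e ij.1)) (diagonal_measure Hdot pB (e ij.2)).
have domAB : dominated_by_family nuAB (finite_product lA lB).
  exact: (dominated_by_family_prod
    (scalar_measure_dominated (Hdot := Hdot) (pE := pA) de hlA)
    (scalar_measure_dominated (Hdot := Hdot) (pE := pB) de hlB)).
have domABC := dominated_by_family_prod domAB
  (scalar_measure_dominated (Hdot := Hdot) (pE := pC) de hlC).
have muN : mu N = 0%E.
  apply: (domABC N mN) => -[[i j] k] /=.
  have := ae_le_bilinear_norm Hdot pA pB pC hGam (e i) (e j) (e k) mpsi psiK M0 GpsiM.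
  have NE : N = ~` [set s | Normc.normc (psi s) <= M].
    by apply/seteqP; split=> s /=; rewrite /N /= ltNge => /negP.
  by rewrite -[X in X -> _]/(negligible _ _) -NE => /(negligibleP _ mN).
rewrite GM; apply: Linf_norm_le; first by rewrite lee_fin.
have psiM : \forall s \ae mu, Normc.normc (psi s) <= M.
  by exists N; split => // s /=; rewrite /N /= ltNge => /negP.
by apply: filterS2 phiK psiM => s; rewrite /psi lee_fin => ->.
Qed.
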